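(* Let $f:\mathbb R^2\to\mathbb C$ be a source function with compact support $\Omega$ such that $(f,\Omega)$ satisfies the source assumption stated in the context, and suppose $\Omega=\bigcup_{m=1}^M\Omega_m$ with $\Omega_m=\{y\in\mathbb R^2: r_m\le|y-y_m|\le R_m\}$, $r_m\ge0$, $R_m>0$, $r_m<R_m$, $y_m\in\mathbb R^2$, $m=1,\dots,M$. Let $\Theta_L=\{\hat x_1,\dots,\hat x_L\}\subset\mathbb S^1$ be a set of $L$ directions no two of which are collinear, and let $0<k_{\min}<k_{\max}$. If $$L>8M-4,$$ then the annuluses $\Omega_m$, $m=1,\dots,M$, can be uniquely determined by the far field patterns $\{u^\infty(\pm\hat x,k) : \hat x\in\Theta_L,\ k\in(k_{\min},k_{\max})\}$.
   Context: Notation. $\mathbb S^1=\{x\in\mathbb R^2:|x|=1\}$; for $\hat x\in\mathbb S^1$, $\hat x^\perp$ is $\hat x$ rotated anticlockwise by $\pi/2$; $l_{\hat x,s}:=\{y\in\mathbb R^2:\hat x\cdot y=s\}$. Source assumption on $(f,\Omega)$, where $\Omega=\operatorname{supp} f$ is compact: (i) $\Omega=\bigcup_{m=1}^M\Omega_m$ where the $\Omega_m$ are compact and pairwise disjoint; each boundary $\partial\Omega_m$ is piecewise $C^1$ with finitely many corners, and the interior of each $\Omega_m$ is a connected domain. (ii) For any $\hat x\in\mathbb S^1$ and any $s\in\mathbb R$ there exist $J(s)<\infty$ and numbers $\alpha_j(s),\beta_j(s)$ with $\beta_j(s)\le\alpha_j(s)$ for $j=1,\dots,J(s)$, $\alpha_j(s)\le\beta_{j+1}(s)$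 for $j=1,\dots,J(s)-1$, and $l_{\hat x,s}\cap\Omega=\bigcup_{j=1}^{J(s)}\{s\hat x+\tau\hat x^\perp:\beta_j(s)\le\tau\le\alpha_j(s)\}$. (iii) $f|_{\Omega_m}\in C^1(\Omega_m)$ for $m=1,\dots,M$, and $f(y)\ne0$ for all $y\in\partial\Omega$. Far field pattern: $u^\infty(\hat x,k)=\int_{\mathbb R^2}e^{-ik\hat x\cdot y}f(y)\,dy$ for $\hat x\in\mathbb S^1$, $k>0$ (the far field pattern of the radiating solution of $\Delta u+k^2u=-f$ in $\mathbb R^2$). ''Uniquely determined'' means: if two sources both satisfy all the hypotheses of the theorem (for the same $\Theta_L,k_{\min},k_{\max}$) and have the same far field patterns $u^\infty(\pm\hat x,k)$ for all $\hat x\in\Theta_L$, $k\in(k_{\min},k_{\max})$, then their collections of annuluses coincide. *)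

(* Defs.v *)
From mathcomp Require Import all_boot all_order all_algebra.
From mathcomp Require Import all_classical all_reals all_analysis.
From mathcomp Require Import complex.

Set Implicit Arguments.
Unset Strict Implicit.
Unset Printing Implicit Defensive.

Import Order.TTheory GRing.Theory Num.Theory numFieldNormedType.Exports.

Local Open Scope classical_set_scope.
Local Open Scope ring_scope.
Local Open Scope complex_scope.

Section Plane.
Variable R : realType.
Implicit Types (x y z : R * R) (A K Omega : set (R * R)) (f : R * R -> R[i]).

Definition dotp x y : R := x.1 * y.1 + x.2 * y.2.

(* The library's norm on [R * R] is the max norm: it induces the right
   topology and notion of derivative, but it is not the Euclidean norm |x|. *)
Definition enorm x : R := Num.sqrt (dotp x x).

Definition perp x : R * R := (- x.2, x.1).

Definition line x (s : R) : set (R * R) := [set y | dotp x y = s].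

(* For nonzero [x] and [y], this is symmetric and means linear dependence. *)
Definition collinear x y : Prop := exists c : R, x = c *: y.

Definition annulus (c : R * R) (rin rout : R) : set (R * R) :=
  [set z | rin <= enorm (z - c) <= rout].

Definition supp f : set (R * R) := closure [set y | f y != 0].

Definition bdry A : set (R * R) := closure A `\` interior A.

(* A simple regular C^1 arc parametrised by [0, 1]. Since [dg] is continuous
   up to 0 and 1, it gives the one-sided derivatives there. *)
Definition C1_arc (g : R -> R * R) : Prop :=
  {within `[0, 1], continuous g} /\
  {in `[0, 1] &, injective g} /\
  exists dg : R -> R * R,
    [/\ {within `[0, 1], continuous dg},
        forall t : R, t \in `]0, 1[ -> is_derive t 1 g (dg t)
      & forall t : R, t \in `[0, 1] -> dg t != 0].

(* A finite union of simple regular C^1 arcs meeting only at end points;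
   the corners are among these end points. *)
Definition piecewise_C1 A : Prop :=
  exists (n : nat) (g : 'I_n -> R -> R * R),
    [/\ forall i, C1_arc (g i),
        A = \bigcup_i (g i @` `[0, 1])
      & forall i j (t u : R), i != j -> t \in `[0, 1] -> u \in `[0, 1] ->
          g i t = g j u ->
          (t = 0 \/ t = 1) /\ (u = 0 \/ u = 1)].

(* C^1 on a compact set, i.e. up to the boundary: [h] is continuous on [K], and
   its partial derivatives exist in the interior and extend continuously to
   [K]. *)
Definition C1_on_real K (h : R * R -> R) : Prop :=
  {within K, continuous h} /\
  forall e : R * R, e = (1, 0) \/ e = (0, 1) ->
    exists dh : R * R -> R,
      {within K, continuous dh} /\
      forall y, interior K y -> is_derive y e h (dh y).

Definition C1_on K f : Prop :=
  C1_on_real K (fun y => complex.Re (f y)) /\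
  C1_on_real K (fun y => complex.Im (f y)).

Definition finitely_many_chords Omega : Prop :=
  forall x (s : R), enorm x = 1 ->
    exists (J : nat) (alpha beta : nat -> R),
      [/\ forall j, (j < J)%N -> beta j <= alpha j,
          forall j, (j.+1 < J)%N -> alpha j <= beta j.+1
        & line x s `&` Omega =
          \bigcup_(j in `I_J)
            [set s *: x + t *: perp x | t in `[beta j, alpha j]]].

Record source_assumption f (M : nat) (Om : 'I_M -> set (R * R)) : Prop :=
  SourceAssumption {
    supp_compact : compact (supp f);
    supp_cover : supp f = \bigcup_m Om m;
    comp_compact : forall m, compact (Om m);
    comp_disjoint : trivIset setT Om;
    comp_bdry : forall m, piecewise_C1 (bdry (Om m));
    comp_domain : forall m,
      interior (Om m) !=set0 /\ connected (interior (Om m));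
    comp_chords : finitely_many_chords (supp f);
    comp_C1 : forall m, C1_on (Om m) f;
    bdry_neq0 : forall y, bdry (supp f) y -> f y != 0
  }.

Definition expi (t : R) : R[i] := cos t +i* sin t.

Definition integral_plane (g : R * R -> R[i]) : R[i] :=
  (\int[(@lebesgue_measure R \x @lebesgue_measure R)%E]_y complex.Re (g y))
  +i* (\int[(@lebesgue_measure R \x @lebesgue_measure R)%E]_y complex.Im (g y)).

Definition far_field f (x : R * R) (k : R) : R[i] :=
  integral_plane (fun y => expi (- (k * dotp x y)) * f y).

End Plane.

(* Main.v *)
Require Import Defs.
From mathcomp Require Import all_boot all_order all_algebra.
From mathcomp Require Import all_classical all_reals all_analysis.
From mathcomp Require Import complex.
From mathcomp Require Import measurable_realfun.
From mathcomp Require Import ring lra zify.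

Import Order.TTheory GRing.Theory Num.Theory numFieldNormedType.Exports.

Local Open Scope classical_set_scope.
Local Open Scope ring_scope.

Set Implicit Arguments.
Unset Strict Implicit.
Unset Printing Implicit Defensive.

(** The far field in the directions [x] and [-x] gives, for [k] in an interval,
the cosine and sine transforms at frequency [k] of [s |-> the integral of f over
the line x . y = s]. A function of compact support is determined by these
transforms on an interval, so two sources with the same data have the same
integrals over every line normal to a direction of [Theta_L].

Extending [f] from each annulus to a Lipschitz function of the plane writes
[f], in each annulus, as a Lipschitz function on the outer disc minus a
Lipschitz function on the inner disc. The integral over the chords of a disc of
radius [rho] is Lipschitz in [s] except at the two tangent lines, where it
behaves like [2 f(p) sqrt (2 rho h)] at distance [h] inside, [p] being the point
of tangency. In the difference of the two sources the singularity of a given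
circle can be cancelled only by another circle with the same tangent line on
the same side. Two circles with distinct centres have such a common tangent for
at most two directions, and concentric distinct circles for none. A circle of
the first source that is not a circle of the second one has at most
[2 M1 - 2 + 2 M2] non-concentric competitors, hence at most
[4 (M1 + M2) - 4 < L] bad directions; a remaining direction gives [f(p) = 0] at
a boundary point. So both sources have the same circles, and as the annuli are
disjoint, those around each centre are recovered from the outside in. *)

(** * Trigonometric integrals *)

Lemma norm_sin_le (R : realType) (x : R) : `|sin x| <= `|x|.
Proof.
wlog x0 : x / 0 <= x.
  move=> H; case: (leP 0 x) => [/H//|/ltW]; rewrite -oppr_ge0 => /H.
  by rewrite sinN !normrN.
have [c _] := @MVT_segment R sin cos 0 x x0 (fun y _ => is_derive_sin y)
  (continuous_subspaceT (@continuous_sin R)).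
rewrite sin0 !subr0 => ->; rewrite normrM ler_piMl//; exact: cos_max.
Qed.

(** The mean value theorem, with [cos] above 3/4 near 0. The 3/4 becomes the 9/32 of [onem_cos_ge],
    and that constant has to exceed the 1/8 in the definition of [q1] in [annihilates_eq0]. *)
Lemma norm_sin_ge (R : realType) :
  exists2 k : R, 0 < k & forall x, `|x| <= k -> 3 / 4 * `|x| <= `|sin x|.
Proof.
have : \forall t \near (0 : R), `|cos 0 - cos t| < 4^-1.
  have /cvgrPdist_lt := @continuous_cos R 0; by apply; rewrite invr_gt0.
rewrite cos0 => /nbhs_ballP[k /= k0 kP].
exists (k / 2); first by rewrite divr_gt0.
move=> x xk; wlog x0 : x xk / 0 <= x.
  move=> H; case: (leP 0 x) => [/H|/ltW]; first by apply.
  by rewrite -oppr_ge0 => /H; rewrite sinN !normrN; exact.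
have [c] := @MVT_segment R sin cos 0 x x0 (fun y _ => is_derive_sin y)
  (continuous_subspaceT (@continuous_sin R)).
rewrite in_itv/= => /andP[c0 cx].
rewrite sin0 !subr0 => ->; rewrite normrM ler_wpM2r//.
have : ball 0 k c.
  rewrite /ball/= sub0r normrN ger0_norm//.
  rewrite (le_lt_trans cx)// (le_lt_trans (ler_norm x))//.
  by rewrite (le_lt_trans xk)// ltr_pdivrMr// ltr_pMr// ltr1n.
move=> /kP /= H; rewrite (le_trans _ (ler_norm _))//.
move: H; rewrite ltr_norml => /andP[_]; lra.
Qed.

Lemma onem_cosE (R : realType) (x : R) : 1 - cos x = 2 * sin (x / 2) ^+ 2.
Proof.
rewrite [in LHS](splitr x) -mulr2n cos_mulr2n sin2cos2 -mulr_natl; ring.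
Qed.

Lemma onem_cos_le (R : realType) (x : R) : 1 - cos x <= x ^+ 2 / 2.
Proof.
have : sin (x / 2) ^+ 2 <= (x / 2) ^+ 2.
  by rewrite -real_normK ?num_real// -[leRHS]real_normK ?num_real//
    lerXn2r ?nnegrE// norm_sin_le.
by rewrite onem_cosE expr_div_n; lra.
Qed.

Lemma onem_cos_ge (R : realType) :
  exists2 k : R, 0 < k &
  forall x, `|x| <= k -> 9 / 32 * x ^+ 2 <= 1 - cos x.
Proof.
have [k k0 kP] := norm_sin_ge R; exists k => // x xk.
have /kP : `|x / 2| <= k.
  rewrite normrM [X in _ * X]ger0_norm ?invr_ge0//.
  by have := normr_ge0 x; lra.
rewrite onem_cosE => H.
have : (3 / 4 * `|x / 2|) ^+ 2 <= `|sin (x / 2)| ^+ 2.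
  by rewrite lerXn2r ?nnegrE// mulr_ge0// divr_ge0.
rewrite exprMn !real_normK ?num_real// !expr_div_n; lra.
Qed.

Lemma integrable_bounded d (T : measurableType d) (R : realType)
    (mu : {measure set T -> \bar R}) (E : set T) (f : T -> R) (B : R) :
  measurable E -> (mu E < +oo)%E -> measurable_fun setT f ->
  (forall x, `|f x| <= B) -> (forall x, ~ E x -> f x = 0) ->
  mu.-integrable setT (EFin \o f).
Proof.
move=> mE muE mf fB fE.
have -> : EFin \o f = (EFin \o f) \_ E.
  apply/funext => x; rewrite patchE; case: ifPn => // /negP.
  by rewrite inE => /fE /= ->.
apply/(integrable_mkcond _ mE).
apply: measurable_bounded_integrable => //; first exact: measurable_funTS.
exists B; split; first exact: num_real.
by move=> x Bx y _ /=; rewrite (le_trans (fB y))// ltW.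
Qed.

(** * Injectivity of the cosine transform on an interval of frequencies *)

Section kernel.
Variable R : realType.
Notation mu := (@lebesgue_measure R).
Variable A : R.
Implicit Types (H F : R -> R).

Definition cont_supp H := continuous H /\ forall s, A < `|s| -> H s = 0.

Lemma cont_suppM (phi H : R -> R) :
  continuous phi -> cont_supp H -> cont_supp (phi \* H).
Proof.
move=> cphi [cH sH]; split; last by move=> s /sH /= ->; rewrite mulr0.
by move=> s; apply: cvgM; [exact: cphi|exact: cH].
Qed.

Lemma cont_supp_integrable H : cont_supp H -> mu.-integrable setT (EFin \o H).
Proof.
move=> [cH sH].
have -> : EFin \o H = (EFin \o H) \_ (`[- A, A]%classic).
  apply/funext => x; rewrite patchE; case: ifPn => // /negP.
  rewrite inE /= in_itv/= -ler_norml => /negP; rewrite -ltNge => /sH /=.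
  by move=> ->.
have mE : measurable (`[- A, A]%classic : set (measurableTypeR R)) by [].
apply/(@integrable_mkcond _ _ _ mu _ _ mE).
apply: continuous_compact_integrable; first exact: segment_compact.
exact: continuous_subspaceT.
Qed.

Lemma continuous_cos_affine (k b : R) : continuous (fun s => cos (k * s + b)).
Proof.
move=> s; apply: (@continuous_comp _ _ _ (fun s => k * s + b) cos).
  by apply: cvgD; [apply: cvgMr; exact: cvg_id|exact: cvg_cst].
exact: continuous_cos.
Qed.

(** The free phase [b] covers sines as well as cosines and makes the condition stable under products
    with cosines. *)
Definition annihilates (delta : R) H := forall k b : R, `|k| < delta ->
  \int[mu]_s (cos (k * s + b) * H s) = 0.

(** A product of two cosines is half the sum of cosines with the frequencies added and subtracted,
    so a cosine factor shifts frequencies by at most [|k0|], and the window shrinks by as much. *)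
Lemma annihilates_step (delta k0 b0 x y : R) H : cont_supp H ->
  annihilates delta H ->
  annihilates (delta - `|k0|) (fun s => (x + y * cos (k0 * s + b0)) * H s).
Proof.
move=> csH aH k b kd.
have mk (p q : R) : mu.-integrable setT (EFin \o (fun s => cos (p * s + q) * H s)).
  by apply: cont_supp_integrable; apply: cont_suppM => //;
    exact: continuous_cos_affine.
have mk' c (p q : R) :
    mu.-integrable setT (EFin \o (fun s => c * (cos (p * s + q) * H s))).
  apply: cont_supp_integrable; apply: (@cont_suppM (cst c)); first by move=> ?; exact: cvg_cst.
  apply: cont_suppM => //; exact: continuous_cos_affine.
transitivity (\int[mu]_s (x * (cos (k * s + b) * H s) +
   (y / 2 * (cos ((k + k0) * s + (b + b0)) * H s) +
   y / 2 * (cos ((k - k0) * s + (b - b0)) * H s)))).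
  apply: eq_Rintegral => s _.
  have -> : (k + k0) * s + (b + b0) = (k * s + b) + (k0 * s + b0) by ring.
  have -> : (k - k0) * s + (b - b0) = (k * s + b) - (k0 * s + b0) by ring.
  move: (k * s + b) (k0 * s + b0) => p q; rewrite cosD cosB; lra.
rewrite RintegralD//; last first.
  exact: (integrableD measurableT (mk' (y / 2) _ _) (mk' (y / 2) _ _)).
rewrite RintegralD// !RintegralZl//.
have kk0 : `|k| + `|k0| < delta by move: kd; rewrite ltrBrDr.
rewrite !aH ?mulr0 ?addr0//.
- by rewrite (le_lt_trans _ kk0)// ler_normB.
- by rewrite (le_lt_trans _ kk0)// ler_normD.
- by rewrite (le_lt_trans _ kk0)// lerDl.
Qed.

Lemma annihilates_iter (delta k0 b0 x y : R) H n : cont_supp H ->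
  annihilates delta H ->
  annihilates (delta - n%:R * `|k0|)
    (fun s => (x + y * cos (k0 * s + b0)) ^+ n * H s).
Proof.
move=> csH aH; elim: n => [|n IH].
  rewrite mul0r subr0 => k b kd.
  by under eq_Rintegral do rewrite expr0 mul1r; exact: aH.
rewrite -addn1 natrD mulrDl mul1r opprD addrA => k b kd.
under eq_Rintegral do rewrite addn1 exprS -mulrA.
apply: annihilates_step kd => //.
apply: (@cont_suppM (fun s => (x + y * cos (k0 * s + b0)) ^+ n)) => // s.
apply: (@continuous_comp _ _ _ (fun s => x + y * cos (k0 * s + b0)) (fun z => z ^+ n)).
  by apply: cvgD; [exact: cvg_cst|apply: cvgMr; exact: continuous_cos_affine].
exact: exprn_continuous.
Qed.

Lemma integrable_indic_itv (a b : R) :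
  mu.-integrable setT (EFin \o (\1_(`[a, b]%classic) : R -> R)).
Proof.
apply: (@integrable_bounded _ _ R mu (`[a, b]%classic)
  (\1_(`[a, b]%classic) : R -> R) 1) => //.
- by rewrite /= lebesgue_measure_itv; case: ifP => _ //; rewrite -EFinD ltry.
- by move=> x; rewrite indicE ger0_norm ?ler0n// lern1 leq_b1.
- by move=> x xab; rewrite indicE memNset.
Qed.

Lemma Rintegral_indic_itv (a b : R) : a <= b ->
  \int[mu]_s (\1_(`[a, b]%classic) s) = b - a.
Proof.
move=> ab; rewrite /Rintegral integral_indic// setIT /= lebesgue_measure_itv/=.
rewrite lte_fin; case: ltP => [_//|ba]; apply/eqP.
by rewrite eq_sym subr_eq0 eq_le ab ba.
Qed.

Lemma cont_supp_bounded H : cont_supp H -> exists2 B, 0 <= B & forall s, `|H s| <= B.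
Proof.
move=> [cH sH]; have [A0|A0] := ltP A 0.
  by exists 0 => // s; rewrite sH ?normr0// (lt_le_trans A0).
have cf : {within `[- A, A], continuous (fun s => `|H s|)}.
  apply: continuous_subspaceT => s.
  by apply: (@continuous_comp _ _ _ H Num.norm); [exact: cH|exact: norm_continuous].
have [|c _ cP] := @EVT_max R _ (- A) A _ cf; first by lra.
exists `|H c| => // s; have [/sH ->|] := ltP A `|s|; first by rewrite normr0.
by rewrite ler_norml => sA; apply: cP; rewrite in_itv.
Qed.

(* [H] is integrated against the powers of
   [q s = 1 - c * (1 - cos (k * (s - s1))) / k ^+ 2], which peak at [s1]. The
   bounds on [q] near and far from [s1] do not depend on [k], so that the power
   [n] can be chosen first, and then [k] with [n * k < delta]. *)
Lemma annihilates_eq0 (delta : R) H : 0 < delta -> cont_supp H ->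
  annihilates delta H -> forall s, H s = 0.
Proof.
move=> d0 csH aH s1; apply/eqP/negPn/negP => Hs1.
(* [H] is multiplied by the constant [H s1], written in the form of [annihilates_step] with [y = 0];
   the value at [s1] becomes a square. *)
wlog Hs1_gt0 : H csH aH {Hs1} / 0 < H s1.
  move=> wl; apply: (wl (fun s => (H s1 + 0 * cos (0 * s + 0)) * H s)).
  - apply: (@cont_suppM (fun s => H s1 + 0 * cos (0 * s + 0))) => // s.
    apply: cvgD; first exact: cvg_cst.
    by apply: cvgMr; exact: continuous_cos_affine.
  - by have := @annihilates_step delta 0 0 (H s1) 0 H csH aH; rewrite normr0 subr0.
  - by rewrite mul0r addr0 -expr2 exprn_even_gt0.
have [cH sH] := csH.
have [B B0 HB] := cont_supp_bounded csH.
have s1A : `|s1| <= A by rewrite leNgt; apply/negP => /sH H0; rewrite H0 ltxx in Hs1_gt0.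
have A0 : 0 <= A := le_trans (normr_ge0 _) s1A.
pose D := A + `|s1| + 1; have D0 : 0 < D by rewrite ltr_wpDl// addr_ge0.
have [r [r0 rD rP]] : exists r, [/\ 0 < r, r <= D &
    forall s, `|s - s1| < r -> H s1 / 2 <= H s].
  have /cvgrPdist_lt/(_ (H s1 / 2)) := cH s1.
  rewrite divr_gt0// => /(_ isT) /nbhs_ballP[r /= r0 rP].
  exists (Num.min r D); split; first by rewrite lt_min r0.
    by rewrite ge_min lexx orbT.
  move=> s; rewrite lt_min => /andP[sr _].
  have /rP /= : ball s1 r s by rewrite /ball/= distrC.
  rewrite ltr_norml => /andP[_]; lra.
(* Every [s] with [|s| <= A] is within [D] of [s1]; there this [c] keeps
   [1 - c * (s - s1) ^+ 2 / 2], a lower bound of [q s], nonnegative. *)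
pose c := 2 / D ^+ 2; have c0 : 0 < c by rewrite divr_gt0// exprn_gt0.
have cD x : `|x| <= D -> c * x ^+ 2 <= 2.
  move=> xD; rewrite /c mulrAC ler_pdivrMr ?exprn_gt0// ler_wpM2l//.
  by rewrite -real_normK ?num_real// lerXn2r ?nnegrE// ltW.
have cr : c * r ^+ 2 <= 2 by apply: cD; rewrite gtr0_norm.
have cr0 : 0 < c * r ^+ 2 by rewrite mulr_gt0// exprn_gt0.
pose q1 := 1 - c * r ^+ 2 / 8.
pose q2 := 1 - 9 / 32 * (c * r ^+ 2).
have q1_gt0 : 0 < q1 by rewrite /q1; lra.
have q2_gt0 : 0 < q2 by rewrite /q2; lra.
have q12 : q2 < q1 by rewrite /q1 /q2; lra.
(* The right side will bound from below the mass on [|s - s1| <= r / 2], an interval of length [r];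
   the left side bounds what the rest of [[- A, A]] can subtract. *)
have [n nP] : exists n, B * (2 * A) * q2 ^+ n < H s1 / 2 * r * q1 ^+ n.
  have q21 : `|q2 / q1| < 1.
    by rewrite ger0_norm ?divr_ge0 ?ltW// ltr_pdivrMr// mul1r.
  have /cvgrPdist_lt/(_ (H s1 / 2 * r)) := cvg_geometric (B * (2 * A)) q21.
  rewrite mulr_gt0 ?divr_gt0// => /(_ isT) [n _ /(_ n (leqnn n))] /=.
  rewrite sub0r normrN => /(le_lt_trans (ler_norm _)).
  rewrite /geometric /= expr_div_n mulrA ltr_pdivrMr ?exprn_gt0// => nP.
  by exists n.
have [ks ks0 ksP] := onem_cos_ge R.
(* The bound [ks / D] puts [k * (s - s1)] in the range of [onem_cos_ge] whenever [s] is within [D]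
   of [s1]. *)
pose k := Num.min (delta / n.+1%:R) (ks / D).
have k0 : 0 < k by rewrite lt_min !divr_gt0.
have kd : n%:R * k < delta.
  have : k <= delta / n.+1%:R by rewrite ge_min lexx.
  rewrite ler_pdivlMr// => kn; apply: lt_le_trans kn.
  by rewrite mulrC ltr_pM2l// ltr_nat.
have kD : k * D <= ks.
  by rewrite -ler_pdivlMr// ge_min lexx orbT.
pose q s := 1 - c / k ^+ 2 + c / k ^+ 2 * cos (k * s + - (k * s1)).
have qE s : q s = 1 - c / k ^+ 2 * (1 - cos (k * (s - s1))).
  by rewrite /q -mulrBr; ring.
have ck0 : 0 < c / k ^+ 2 by rewrite divr_gt0// exprn_gt0.
have kn0 : k != 0 by rewrite gt_eqF.
have q_ge s : 1 - c * (s - s1) ^+ 2 / 2 <= q s.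
  rewrite qE lerD2l lerN2 (le_trans (ler_wpM2l (ltW ck0) (onem_cos_le _)))//.
  by rewrite exprMn le_eqVlt; apply/orP; left; apply/eqP; field.
have q_le s : `|s - s1| <= D -> q s <= 1 - 9 / 32 * (c * (s - s1) ^+ 2).
  move=> sD; rewrite qE lerD2l lerN2.
  have /ksP : `|k * (s - s1)| <= ks.
    by rewrite normrM gtr0_norm// (le_trans _ kD)// ler_pM2l.
  move=> /(ler_wpM2l (ltW ck0)); apply: le_trans.
  by rewrite exprMn le_eqVlt; apply/orP; left; apply/eqP; field.
have aqH : \int[mu]_s (q s ^+ n * H s) = 0.
  have /(_ 0 0) := @annihilates_iter delta k (- (k * s1))
    (1 - c / k ^+ 2) (c / k ^+ 2) H n csH aH.
  rewrite normr0 subr_gt0 gtr0_norm// => /(_ kd).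
  by under eq_Rintegral do rewrite mul0r addr0 cos0 mul1r.
pose E1 : set R := `[s1 - r / 2, s1 + r / 2]%classic.
pose E2 : set R := `[- A, A]%classic.
have i1 u : mu.-integrable setT (EFin \o (fun s => u * (\1_E1 s : R))).
  by apply: (@integrableZl _ _ _ mu setT measurableT u (EFin \o \1_E1));
    exact: integrable_indic_itv.
have i2 u : mu.-integrable setT (EFin \o (fun s => u * (\1_E2 s : R))).
  by apply: (@integrableZl _ _ _ mu setT measurableT u (EFin \o \1_E2));
    exact: integrable_indic_itv.
(* This step function lies below [q s ^+ n * H s]: within [r / 2] of [s1] by [q1], between [r / 2]
   and [r] because the product is nonnegative, beyond [r] by [q2]. Its integral is positive by the
   choice of [n]. *)
have : \int[mu]_s (H s1 / 2 * q1 ^+ n * \1_E1 s - B * q2 ^+ n * \1_E2 s) <= 0.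
  rewrite -aqH; apply: le_Rintegral => //.
  - exact: (integrableB measurableT (i1 _) (i2 _)).
  - apply: cont_supp_integrable; apply: (@cont_suppM (fun s => q s ^+ n)) => // s.
    apply: (@continuous_comp _ _ _ q (fun z => z ^+ n)); last exact: exprn_continuous.
    by apply: cvgD; [exact: cvg_cst|apply: cvgMr; exact: continuous_cos_affine].
  move=> s _.
  have E1P : (s \in E1) = (`|s - s1| <= r / 2).
    by rewrite mem_setE in_itv/= ler_distl.
  have E2P : (s \in E2) = (`|s| <= A) by rewrite mem_setE in_itv/= ler_norml.
  have I1 : \1_E1 s = (if `|s - s1| <= r / 2 then 1 else 0) :> R.
    by rewrite indicE E1P; case: ifP.
  have I2 : \1_E2 s = (if `|s| <= A then 1 else 0) :> R.
    by rewrite indicE E2P; case: ifP.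
  rewrite I1 I2.
  have [sA|sA] := leP `|s| A; last first.
    rewrite (sH s)// !mulr0 subr0; have [sr|_] := leP `|s - s1| (r / 2); last by rewrite mulr0.
    have := rP s; rewrite (le_lt_trans sr) ?(sH s)// ?ltr_pdivrMr// ?ltr_pMr ?ltr1n//.
    by move=> /(_ isT); lra.
  have sD : `|s - s1| <= D.
    by rewrite (le_trans (ler_normB _ _))// /D -addrA lerD// lerDl.
  have q0 : 0 <= q s by rewrite (le_trans _ (q_ge s))//; have := cD _ sD; lra.
  have Bq : 0 <= B * q2 ^+ n by rewrite mulr_ge0// exprn_ge0// ltW.
  rewrite mulr1.
  have [sr|sr] := leP `|s - s1| (r / 2).
    rewrite mulr1; apply: (@le_trans _ _ (H s1 / 2 * q1 ^+ n)); first by rewrite gerBl.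
    have q1q : q1 <= q s.
      rewrite (le_trans _ (q_ge s))// /q1.
      have : (s - s1) ^+ 2 <= (r / 2) ^+ 2.
        rewrite -real_normK ?num_real// lerXn2r ?nnegrE//.
        by rewrite divr_ge0// ltW.
      move=> /(ler_wpM2l (ltW c0)); rewrite expr_div_n; lra.
    have Hs : H s1 / 2 <= H s.
      by apply: rP; rewrite (le_lt_trans sr)// ltr_pdivrMr// ltr_pMr// ltr1n.
    rewrite mulrC ler_pM//.
    - by rewrite exprn_ge0// ltW.
    - by rewrite divr_ge0// ltW.
    - by rewrite lerXn2r ?nnegrE// ltW.
  rewrite mulr0 sub0r; have [sr'|sr'] := ltP `|s - s1| r.
    apply: (@le_trans _ _ 0); first by rewrite oppr_le0.
    by rewrite mulr_ge0 ?exprn_ge0// (le_trans _ (rP _ sr'))// divr_ge0// ltW.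
  rewrite lerNl (le_trans (ler_norm _))// normrN normrM mulrC ler_pM//.
  rewrite normrX ger0_norm// lerXn2r ?nnegrE ?(ltW q2_gt0)//.
  rewrite (le_trans (q_le _ sD))// /q2 lerD2l lerN2 ler_pM2l// ler_pM2l//.
  by rewrite -[leRHS]real_normK ?num_real// lerXn2r ?nnegrE// ltW.
rewrite RintegralB//.
rewrite !RintegralZl//; [|exact: integrable_indic_itv..].
rewrite !Rintegral_indic_itv//; [|by lra..].
by move: nP; lra.
Qed.

(** Multiplying [F] by a cosine of the middle frequency [k0] moves the window [(kmin, kmax)] to one
    centred at 0. The phase is chosen so that the factor is 1 at [s1], the point under test. *)
Lemma cos_transform_inj (kmin kmax : R) F : kmin < kmax -> cont_supp F ->
  (forall k b, kmin < k < kmax -> \int[mu]_s (cos (k * s + b) * F s) = 0) ->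
  forall s, F s = 0.
Proof.
move=> kk csF aF s1.
pose k0 := (kmin + kmax) / 2; pose delta := (kmax - kmin) / 2.
have d0 : 0 < delta by rewrite /delta; lra.
pose H s := (0 + 1 * cos (k0 * s + - (k0 * s1))) * F s.
have csH : cont_supp H.
  apply: (@cont_suppM (fun s => 0 + 1 * cos (k0 * s + - (k0 * s1)))) => // s.
  apply: cvgD; first exact: cvg_cst.
  by apply: cvgMr; exact: continuous_cos_affine.
suff aH : annihilates delta H.
  have := annihilates_eq0 d0 csH aH s1.
  by rewrite /H subrr cos0 add0r !mul1r.
have iF k b c : mu.-integrable setT (EFin \o (fun s => c * (cos (k * s + b) * F s))).
  apply: cont_supp_integrable; apply: (@cont_suppM (cst c)); first by move=> ?; exact: cvg_cst.
  by apply: cont_suppM => //; exact: continuous_cos_affine.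
have iF1 k b : mu.-integrable setT (EFin \o (fun s => (cos (k * s + b) * F s))).
  by apply: cont_supp_integrable; apply: cont_suppM => //; exact: continuous_cos_affine.
move=> k b; rewrite ltr_norml => /andP[dk kd].
transitivity (\int[mu]_s (1 / 2 * (cos ((k0 + k) * s + (b - k0 * s1)) * F s) +
   1 / 2 * (cos ((k0 - k) * s + (- b - k0 * s1)) * F s))).
  apply: eq_Rintegral => s _; rewrite /H.
  have -> : (k0 + k) * s + (b - k0 * s1) = (k * s + b) + (k0 * s - k0 * s1) by ring.
  have -> : (k0 - k) * s + (- b - k0 * s1) = (k0 * s - k0 * s1) - (k * s + b) by ring.
  by move: (k * s + b) (k0 * s - k0 * s1) => p q; rewrite cosD cosB; lra.
rewrite RintegralD//; [|exact: iF..].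
rewrite !RintegralZl//; [|exact: iF1..].
by rewrite !aF ?mulr0 ?addr0//; apply/andP; split; move: dk kd; rewrite /k0 /delta; lra.
Qed.

End kernel.

(** * Rotations preserve the Lebesgue measure of the plane *)

Section plane_measure.
Variable R : realType.
Notation mu := (@lebesgue_measure R).
Notation mu2 := (mu \x mu)%E.
Local Notation plane := (measurableTypeR R * measurableTypeR R)%type.

Lemma lebesgue_measure_shift (a : R) (A : set (measurableTypeR R)) : measurable A ->
  mu ((fun x : measurableTypeR R => x + a : measurableTypeR R) @^-1` A) = mu A.
Proof.
pose f := fun x : measurableTypeR R => x + a : measurableTypeR R.
have mf : measurable_fun setT f.
  by apply: measurable_funD => //.
move=> mA; apply/esym.
apply: (@lebesgue_measure_unique R (pushforward mu f)) => // X [[u v] _ <-].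
have fE : f @^-1` `]u, v]%classic = `]u - a, v - a]%classic.
  by apply/seteqP; split => x /=; rewrite !in_itv/= /f ltrBlDr lerBrDr.
rewrite /pushforward -[X in X = _]/(mu `]u, v]%classic).
rewrite -[X in _ = X]/(mu (f @^-1` `]u, v]%classic)) fE.
rewrite !lebesgue_measure_itv/= !lte_fin ltrD2r.
by case: ifP => // _; rewrite -!EFinB; congr EFin; ring.
Qed.

Definition preserving (T : plane -> plane) :=
  measurable_fun setT T /\ forall A, measurable A -> mu2 (T @^-1` A) = mu2 A.

Lemma preserving_comp S T : preserving S -> preserving T ->
  preserving (S \o T).
Proof.
move=> [mS S2] [mT T2]; split; first exact: measurableT_comp.
move=> A mA; rewrite comp_preimage T2 ?S2//.
by rewrite -[X in measurable X]setTI; exact: mS.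
Qed.

Lemma mu2E (X : set plane) : measurable X -> mu2 X = (mu \x^ mu)%E X.
Proof.
by move=> mX; apply: product_measure_unique => // A B mA mB /=; rewrite product_measure2E.
Qed.

Lemma preserving_rect (T : plane -> plane) : measurable_fun setT T ->
  (forall A B : set (measurableTypeR R), measurable A -> measurable B ->
    mu2 (T @^-1` (A `*` B)) = (mu A * mu B)%E) ->
  preserving T.
Proof.
move=> mT TAB; split=> // X mX; apply/esym.
by apply: (@product_measure_unique _ _ _ _ _ mu mu (pushforward mu2 T)).
Qed.

(** On a slice with fixed second coordinate the shear is a translation; [mu2E] permits slicing in
    that direction. *)
Lemma preserving_shear1 (a : R) :
  preserving (fun z : plane => (z.1 + a * z.2, z.2) : plane).
Proof.
set T := fun z => _.
have mT : measurable_fun setT T.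
  apply: measurable_fun_pair; last exact: measurable_snd.
  apply: measurable_funD; first exact: measurable_fst.
  by apply: measurable_funM => //; exact: measurable_snd.
apply: preserving_rect => // A B mA mB.
rewrite mu2E; last first.
  by rewrite -[X in measurable X]setTI; apply: mT => //; exact: measurableX.
rewrite /product_measure2.
transitivity (\int[mu]_(x in B) (mu A))%E; last by rewrite integral_cst.
rewrite [RHS]integral_mkcond; apply: eq_integral => y _ /=.
rewrite patchE; case: ifPn => [|/negP] yB.
  rewrite -(lebesgue_measure_shift (a * y) mA); congr (mu _).
  apply/seteqP; split => x /=; rewrite ysectionE/= /T/=; first by case.
  by rewrite inE in yB.
rewrite inE in yB.
rewrite (_ : ysection _ _ = set0) ?measure0//.
by apply/seteqP; split => x //=; rewrite ysectionE => -[].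
Qed.

Lemma preserving_swap : preserving (fun z : plane => (z.2, z.1) : plane).
Proof.
set T := fun z => _.
have mT : measurable_fun setT T.
  by apply: measurable_fun_pair; [exact: measurable_snd|exact: measurable_fst].
apply: preserving_rect => // A B mA mB.
have -> : T @^-1` (A `*` B) = B `*` A.
  by apply/seteqP; split => -[x y] [].
by rewrite product_measure1E// muleC.
Qed.

Lemma preserving_ext S T : S =1 T -> preserving S -> preserving T.
Proof. by move=> /funext ->. Qed.

Lemma preserving_shear2 (a : R) :
  preserving (fun z : plane => (z.1, z.2 + a * z.1) : plane).
Proof.
apply: preserving_ext (preserving_comp preserving_swap
  (preserving_comp (preserving_shear1 a) preserving_swap)).
by move=> [].
Qed.

(** For a unit vector [th], the first coordinate selects a line normal to [th] and the second is arc
    length along it. *)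
Definition rot (th : R * R) (z : plane) : plane := z.1 *: th + z.2 *: perp th.

Lemma rotE th z : rot th z = (z.1 * th.1 - z.2 * th.2, z.1 * th.2 + z.2 * th.1).
Proof. by rewrite /rot /perp; congr pair => /=; rewrite /GRing.scale/= mulrN. Qed.

Lemma enorm1_dotp (th : R * R) : enorm th = 1 -> dotp th th = 1.
Proof.
move=> th1; have : dotp th th = Num.sqrt (dotp th th) ^+ 2.
  by rewrite sqr_sqrtr// addr_ge0// -expr2 sqr_ge0.
by rewrite -/(enorm th) th1 expr1n.
Qed.

(* A rotation by an angle other than [pi] is a product of three shears. *)
Lemma preserving_rot th : enorm th = 1 -> preserving (rot th).
Proof.
have main (v : R * R) : dotp v v = 1 -> 1 + v.1 != 0 -> preserving (rot v).
  move=> v1 vN.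
  (* For [v] at angle phi the shears have parameters - tan (phi / 2) and sin phi. *)
  have S1 := preserving_shear1 (- v.2 / (1 + v.1)).
  have S2 := preserving_shear2 v.2.
  apply: preserving_ext (preserving_comp S1 (preserving_comp S2 S1)).
  move=> [x y]; rewrite rotE/=.
  have E : v.2 ^+ 2 = (1 - v.1) * (1 + v.1) by move: v1; rewrite /dotp => v1; lra.
  have E1 : v.2 * (- v.2 / (1 + v.1)) = v.1 - 1.
    by rewrite mulrA mulrN -expr2 E; field.
  have E2 : - v.2 / (1 + v.1) * (v.1 + 1) = - v.2 by field.
  move: E1 E2; move: (- v.2 / (1 + v.1)) => a E1 E2.
  congr pair.
    transitivity (x + (v.2 * a) * x + (a * (v.1 + 1) + a * (v.2 * a - (v.1 - 1))) * y);
      first by ring.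
    by rewrite E2 E1; ring.
  transitivity (v.2 * x + y * (1 + v.2 * a)); first by ring.
  by rewrite E1; ring.
move=> /enorm1_dotp th1.
have [thN|] := eqVneq (1 + th.1) 0; last exact: main.
have th1N : th.1 = -1 by move: thN; lra.
have th20 : th.2 = 0.
  apply/eqP; rewrite -sqrf_eq0; apply/eqP.
  by move: th1; rewrite /dotp th1N -expr2; lra.
(* The remaining rotation, the half turn, is the square of a quarter turn. *)
have P01 : preserving (rot (0, 1)).
  by apply: main; rewrite /dotp/= ?mulr0 ?mulr1 ?add0r ?addr0.
apply: preserving_ext (preserving_comp P01 P01).
by move=> [x y] /=; rewrite !rotE/= th1N th20; congr pair; ring.
Qed.

End plane_measure.

(** * Integration along the lines normal to a direction *)

Lemma lt_sqr_norm (R : realDomainType) (A t : R) : `|A| + 1 < `|t| -> A < t ^+ 2.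
Proof.
move=> At; have : (`|A| + 1) ^+ 2 < t ^+ 2.
  by rewrite -[ltRHS]real_normK ?num_real// ltrXn2r ?nnegrE// addr_ge0.
have := ler_norm A; have := sqr_ge0 `|A|; have := normr_ge0 A.
by rewrite sqrrD1; lra.
Qed.

Section projection.
Variable R : realType.
Notation mu := (@lebesgue_measure R).
Notation mu2 := (mu \x mu)%E.
Local Notation plane := (measurableTypeR R * measurableTypeR R)%type.

(** An open set is the union of the boxes with rational centre and size that it contains, and these
    are countably many. *)
Lemma open_measurable_plane (U : set (R * R)) : open U -> measurable (U : set plane).
Proof.
move=> oU.
pose box (q : rat * rat * rat) : set plane :=
  `]ratr q.1.1 - ratr q.2, ratr q.1.1 + ratr q.2[%classic `*`
  `]ratr q.1.2 - ratr q.2, ratr q.1.2 + ratr q.2[%classic.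
have -> : U = \bigcup_(q in [set q | box q `<=` U]) box q.
  apply/seteqP; split => [z Uz|z [q qU]]; last exact: qU.
  have /nbhs_ballP[e /= e0 eU] := open_nbhs_nbhs (conj oU Uz).
  have [d /andP[d0 de]] : exists d : rat, (0 < (ratr d : R) < e / 2).
    have [d] := @rat_in_itvoo R 0 (e / 2) (divr_gt0 e0 (ltr0n _ 2)).
    by rewrite in_itv/=; exists d.
  have near x : exists q : rat, `|x - (ratr q : R)| < ratr d.
    have [q] := @rat_in_itvoo R (x - ratr d) (x + ratr d) ltac:(lra).
    by rewrite in_itv/= -ltr_distlC => ?; exists q.
  have [q1 q1P] := near z.1; have [q2 q2P] := near z.2.
  exists (q1, q2, d) => /=; last first.
    by split; rewrite /= in_itv/= -ltr_distl.
  move=> y [/=]; rewrite !in_itv/= -!ltr_distl => y1 y2.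
  apply: eU; split; rewrite /ball/=.
    by move: q1P y1; rewrite !ltr_norml; move=> /andP[? ?] /andP[? ?]; apply/andP; split; lra.
  by move: q2P y2; rewrite !ltr_norml; move=> /andP[? ?] /andP[? ?]; apply/andP; split; lra.
rewrite bigcup_mkcond; apply: countable_bigcupT_measurable.
  exact: countableP.
by move=> q; case: ifPn => // _; apply: measurableX; exact: measurable_itv.
Qed.

Lemma continuous_measurable_plane (g : R * R -> R) : continuous g ->
  measurable_fun setT (g : plane -> R).
Proof.
move=> /continuousP cg.
apply: (measurability _ (RGenOInfty.measurableE R)).
move=> /= _ [_ [a ->]] <-; rewrite setTI; apply: open_measurable_plane.
by apply: cg; exact: interval_open.
Qed.

Lemma dotp_rot (th : R * R) z : enorm th = 1 -> dotp th (rot th z) = z.1.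
Proof.
move=> /enorm1_dotp th1.
rewrite rotE /dotp/= -[RHS]mulr1 -th1 /dotp; ring.
Qed.

Lemma dotp_rot2 (th : R * R) z : enorm th = 1 ->
  dotp (rot th z) (rot th z) = z.1 ^+ 2 + z.2 ^+ 2.
Proof.
move=> /enorm1_dotp th1.
rewrite rotE /dotp/= -[RHS]mulr1 -th1 /dotp; ring.
Qed.

Lemma plane_integrable (f : R * R -> R) (A B : R) :
  measurable_fun setT (f : plane -> R) -> (forall z, `|f z| <= B) ->
  (forall z, A < dotp z z -> f z = 0) -> mu2.-integrable setT (EFin \o f).
Proof.
move=> mf fB fA; pose K := `|A| + 1.
pose E : set plane := `[- K, K]%classic `*` `[- K, K]%classic.
have mE : measurable E by apply: measurableX; exact: measurable_itv.
have muE : (mu2 E < +oo)%E.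
  rewrite product_measure1E//; [|exact: measurable_itv..].
  rewrite /= lebesgue_measure_itv/=; case: ifP => _; last by rewrite mule0 ltry.
  by rewrite -EFinD -EFinM ltry.
apply: (integrable_bounded mE muE mf fB) => z zE.
rewrite fA// ltNge; apply/negP => zA; apply: zE.
have : z.1 ^+ 2 <= K ^+ 2 /\ z.2 ^+ 2 <= K ^+ 2.
  have := sqr_ge0 z.1; have := sqr_ge0 z.2.
  have := ler_norm A; have := sqr_ge0 `|A|; have := normr_ge0 A.
  by move: zA; rewrite /K sqrrD1 /dotp -!expr2; split; lra.
have K0 : 0 <= K by rewrite addr_ge0.
rewrite -[z.1 ^+ 2]real_normK ?num_real// -[z.2 ^+ 2]real_normK ?num_real//.
by rewrite !ler_sqr ?nnegrE// !ler_norml => -[z1 z2]; split; rewrite /= in_itv.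
Qed.

Section line_integral.
Variables (H : R * R -> R) (A B : R).
Hypothesis mH : measurable_fun setT (H : plane -> R).
Hypothesis HB : forall z, `|H z| <= B.
Hypothesis HA : forall z, A < dotp z z -> H z = 0.

Lemma line_integrable (th : R * R) (s : R) : enorm th = 1 ->
  mu.-integrable setT (EFin \o (fun t => H (rot th (s, t)))).
Proof.
move=> th1; have [mrot _] := preserving_rot th1.
apply: (@integrable_bounded _ _ R mu (`[- (`|A| + 1), `|A| + 1]%classic)
  (fun t => H (rot th (s, t))) B) => //.
- by rewrite /= lebesgue_measure_itv; case: ifP => _ //; rewrite -EFinD ltry.
- exact: (measurableT_comp (measurableT_comp mH mrot) (pair1_measurable s)).
- move=> t /=; rewrite in_itv/= -ler_norml => /negP; rewrite -ltNge => tA.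
  apply: HA; rewrite dotp_rot2//=.
  by rewrite (lt_le_trans (lt_sqr_norm tA))// lerDr sqr_ge0.
Qed.

Lemma measurable_dotp (th : R * R) : measurable_fun setT (dotp th : plane -> R).
Proof. by apply: measurable_funD; apply: measurable_funM => //. Qed.

Lemma weighted_integrable (phi : R -> R) (C : R) (th : R * R) :
  measurable_fun setT phi -> (forall x, `|phi x| <= C) ->
  mu2.-integrable setT (EFin \o (fun y => phi (dotp th y) * H y)).
Proof.
move=> mphi phiC; apply: (@plane_integrable _ A (C * B)).
- by apply: measurable_funM => //; apply: measurableT_comp => //; exact: measurable_dotp.
- by move=> z; rewrite normrM ler_pM.
- by move=> z /HA ->; rewrite mulr0.
Qed.

(** Change of variables by the rotation, then Fubini: [dotp th] becomes the first coordinate, so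
    that [phi] leaves the inner integral. *)
Lemma integral_rot (phi : R -> R) (C : R) (th : R * R) : enorm th = 1 ->
  measurable_fun setT phi -> (forall x, `|phi x| <= C) ->
  \int[mu2]_y (phi (dotp th y) * H y) =
  \int[mu]_s (phi s * \int[mu]_t (H (rot th (s, t)))).
Proof.
move=> th1 mphi phiC; have [mrot rot2] := preserving_rot th1.
pose f (z : plane) : R := phi (dotp th z) * H z.
have mf : measurable_fun setT f.
  by apply: measurable_funM => //; apply: measurableT_comp => //; exact: measurable_dotp.
have ifrot : mu2.-integrable setT (EFin \o (f \o rot th)).
  apply: (@plane_integrable _ A (C * B)); first exact: measurableT_comp.
    by move=> z; rewrite /= /f normrM ler_pM.
  move=> z Az; rewrite /= /f HA ?mulr0//.
  by rewrite dotp_rot2// !expr2.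
transitivity (\int[mu2]_y (f (rot th y))).
  rewrite /Rintegral; congr fine.
  transitivity (\int[pushforward mu2 (rot th)]_y (f y)%:E)%E.
    by apply: eq_measure_integral => X mX _; exact/esym/rot2.
  rewrite integral_pushforward//.
  exact/measurable_EFinP.
rewrite /Rintegral -(integral12_prod_meas1 ifrot); congr fine.
apply: eq_integral => s _; rewrite /fubini_F/=.
under eq_integral do rewrite /f dotp_rot//= EFinM.
rewrite integralZl//; last exact: line_integrable.
rewrite EFinM fineK//; apply: integrable_fin_num => //.
exact: line_integrable.
Qed.

End line_integral.

End projection.

(** * Integrals over the chords of a disc *)

Lemma norm_component_le (R : realType) (th : R * R) : enorm th = 1 ->
  `|th.1| <= 1 /\ `|th.2| <= 1.
Proof.
move=> /enorm1_dotp th1.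
move: th1; rewrite /dotp -!expr2 => th1.
have := sqr_ge0 th.1; have := sqr_ge0 th.2.
by split; rewrite -ler_sqr ?nnegrE// real_normK ?num_real// expr1n; lra.
Qed.

Section disc.
Variable R : realType.
Notation mu := (@lebesgue_measure R).

(* The disc is closed if [b] holds and open otherwise. *)
Definition in_disc (b : bool) (c : R * R) (rho : R) (z : R * R) : bool :=
  dotp (z - c) (z - c) < rho ^+ 2 ?<= if b.

Definition on_disc b c rho (g : R * R -> R) (z : R * R) : R :=
  if in_disc b c rho z then g z else 0.

Definition lip (L : R) (g : R * R -> R) :=
  forall x y, `|g x - g y| <= L * `|x - y|.

Lemma lip_continuous L g : lip L g -> continuous g.
Proof.
move=> gL x; have L1 : 0 < `|L| + 1 by rewrite ltr_wpDl.
apply/cvgrPdist_lt => e e0.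
apply: (filterS _ (nbhsx_ballx x _ (divr_gt0 e0 L1))) => y [xy1 xy2].
have : `|x - y| < e / (`|L| + 1) by rewrite [`|x - y|]/Num.norm/= gt_max xy1 xy2.
rewrite ltr_pdivlMr// mulrC; apply: le_lt_trans; apply: le_trans (gL x y) _.
by rewrite ler_wpM2r// (le_trans (ler_norm _))// lerDl.
Qed.

Lemma norm_pair_le (x : R * R) e : (`|x| <= e) = (`|x.1| <= e) && (`|x.2| <= e).
Proof. by rewrite /Num.norm/= ge_max. Qed.

Lemma norm_le_dotp (x : R * R) (r : R) : 0 <= r -> dotp x x <= r ^+ 2 -> `|x| <= r.
Proof.
move=> r0; rewrite /dotp -!expr2 => xr; rewrite norm_pair_le.
have := sqr_ge0 x.1; have := sqr_ge0 x.2.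
by rewrite -[_ <= r]ler_sqr ?nnegrE// -[X in _ && X]ler_sqr ?nnegrE//
  !real_normK ?num_real// => ? ?; apply/andP; split; lra.
Qed.

(** Made for the difference of two chords with common midpoint [tau]: [a] bounds it where both are
    present, [b] on the two end pieces between the half-lengths [m] and [M]. *)
Lemma Rintegral_shell_le (f : R -> R) (a b tau r m M : R) :
  0 <= a -> 0 <= b ->
  0 <= r -> 0 <= m <= M -> mu.-integrable setT (EFin \o f) ->
  (forall t, `|f t| <= (if `|t - tau| <= r then a else 0) +
                      (if m <= `|t - tau| <= M then b else 0)) ->
  `|\int[mu]_t f t| <= 2 * a * r + 2 * b * (M - m).
Proof.
move=> a0 b0 r0 /andP[m0 mM] intf fab.
pose E0 : set R := `[tau - r, tau + r]%classic.
pose E1 : set R := `[tau - M, tau - m]%classic.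
pose E2 : set R := `[tau + m, tau + M]%classic.
have iZ u v (c : R) :
    mu.-integrable setT (EFin \o (fun s => c * (\1_(`[u, v]%classic) s : R))).
  apply: (@integrableZl _ _ _ mu setT measurableT c (EFin \o \1_(`[u, v]%classic))).
  exact: integrable_indic_itv.
have fin t : `|f t| <= a * \1_E0 t + (b * \1_E1 t + b * \1_E2 t).
  have E0P : (t \in E0) = (`|t - tau| <= r) by rewrite mem_setE in_itv/= ler_distl.
  have E12 : (m <= `|t - tau| <= M) -> (t \in E1) || (t \in E2).
    rewrite !mem_setE !in_itv/= => /andP[].
    rewrite ler_norml ler_normr opprB => /orP[mt|mt] /andP[Mt tM];
      apply/orP; [right|left]; apply/andP; split; lra.
  apply: le_trans (fab t) _; rewrite !indicE E0P; apply: lerD.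
    by case: ifP => _; rewrite ?mulr1 ?mulr0.
  case: ifPn => [/E12/orP[]->|_]; last by rewrite addr_ge0// mulr_ge0.
    by rewrite mulr1 lerDl mulr_ge0.
  by rewrite mulr1 lerDr mulr_ge0.
have i12 : mu.-integrable setT (EFin \o (fun t => b * \1_E1 t + b * \1_E2 t)).
  exact: (integrableD measurableT (iZ _ _ b) (iZ _ _ b)).
have i012 : mu.-integrable setT
    (EFin \o (fun t => a * \1_E0 t + (b * \1_E1 t + b * \1_E2 t))).
  exact: (integrableD measurableT (iZ _ _ a) i12).
apply: le_trans (le_normr_Rintegral measurableT intf) _.
apply: (@le_trans _ _ (\int[mu]_t (a * \1_E0 t + (b * \1_E1 t + b * \1_E2 t)))).
  apply: le_Rintegral => //.
  exact: (integrable_norm intf).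
rewrite RintegralD//; last exact: iZ.
rewrite RintegralD//; [|exact: iZ..].
rewrite !RintegralZl//; [|exact: integrable_indic_itv..].
rewrite !Rintegral_indic_itv; [|by lra..].
by rewrite le_eqVlt; apply/orP; left; apply/eqP; ring.
Qed.

End disc.

(** * Half-length of a chord as a function of its distance to the centre *)

Section sqrt_chord.
Variables (R : realType) (rho : R).
Hypothesis rho0 : 0 <= rho.
Implicit Types u h : R.

(** On lines that miss the disc, the convention that the square root of a negative number is 0 gives
    the right value. *)
Definition halfchord u : R := Num.sqrt (rho ^+ 2 - u ^+ 2).

Lemma halfchord_ge0 u : 0 <= halfchord u. Proof. exact: sqrtr_ge0. Qed.

Lemma halfchord_le u : halfchord u <= rho.
Proof.
rewrite -[leRHS]ger0_norm// -sqrtr_sqr ler_sqrt ?sqr_ge0//.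
by rewrite gerBl sqr_ge0.
Qed.

Lemma halfchord_leP u v : u ^+ 2 + v ^+ 2 <= rho ^+ 2 -> `|v| <= halfchord u.
Proof.
move=> H; rewrite -sqrtr_sqr ler_wsqrtr//; lra.
Qed.

Lemma halfchord_geP u v : rho ^+ 2 <= u ^+ 2 + v ^+ 2 -> halfchord u <= `|v|.
Proof.
move=> H; rewrite -sqrtr_sqr ler_wsqrtr//; lra.
Qed.

Lemma halfchord_eq0 u : rho <= `|u| -> halfchord u = 0.
Proof.
move=> ru; apply/eqP; rewrite sqrtr_eq0 subr_le0.
by rewrite -[leRHS]real_normK ?num_real// ler_sqr ?nnegrE.
Qed.

Lemma halfchord_continuous : continuous halfchord.
Proof.
move=> u; apply: (@continuous_comp _ _ _ (fun u => rho ^+ 2 - u ^+ 2) Num.sqrt).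
  by apply: cvgB; [exact: cvg_cst|exact: exprn_continuous].
exact: sqrt_continuous.
Qed.

(* The chord length fails to be Lipschitz only at [rho], on its left, and at
   [- rho], on its right. *)
Lemma halfchord_left_lip u : u != rho -> exists K h0 : R,
  [/\ 0 <= K, 0 < h0 &
      forall h, 0 <= h -> h <= h0 -> `|halfchord (u - h) - halfchord u| <= K * h].
Proof.
move=> ur; have [ru|ur'] := ltP rho u.
  exists 0, (u - rho); split => //; first by lra.
  move=> h h0 hu; rewrite !halfchord_eq0 ?subrr ?normr0 ?mul0r//.
    by rewrite (le_trans (ltW ru))// ler_norm.
  by rewrite (le_trans _ (ler_norm _))//; lra.
have {ur ur'}ur : u < rho by rewrite lt_neqAle ur.
have [ru|ru] := leP u (- rho).
  exists 0, 1; split => // h h0 _.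
  rewrite !halfchord_eq0 ?subrr ?normr0 ?mul0r// ler_normr; apply/orP; right; lra.
have u2 : 0 < rho ^+ 2 - u ^+ 2.
  by rewrite subr_sqr mulr_gt0//; lra.
have w0 : 0 < halfchord u by rewrite sqrtr_gt0.
(* A difference of square roots is the difference of the squares, here [h * (2 * u - h)], over their
   sum, which is at least [halfchord u]. *)
exists ((2 * rho + 1) / halfchord u), 1; split => //.
  by rewrite divr_ge0 ?ltW//; lra.
move=> h h0 h1; rewrite mulrAC ler_pdivlMr// -[X in _ * X]gtr0_norm// -normrM.
have E : halfchord u ^+ 2 = rho ^+ 2 - u ^+ 2 by rewrite sqr_sqrtr// ltW.
have uh : `|h * (2 * u - h)| <= (2 * rho + 1) * h.
  rewrite normrM (ger0_norm h0) mulrC ler_wpM2r//.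
  rewrite ler_norml; apply/andP; split; lra.
apply: le_trans uh.
have [uh0|uh0] := leP (rho ^+ 2 - (u - h) ^+ 2) 0.
  have -> : halfchord (u - h) = 0 by apply/eqP; rewrite sqrtr_eq0.
  rewrite sub0r mulNr normrN -expr2 E (ger0_norm (ltW u2)).
  rewrite ler_normr; apply/orP; right; lra.
have E' : halfchord (u - h) ^+ 2 = rho ^+ 2 - (u - h) ^+ 2 by rewrite sqr_sqrtr// ltW.
have -> : h * (2 * u - h) =
    (halfchord (u - h) - halfchord u) * (halfchord (u - h) + halfchord u).
  rewrite -subr_sqr E E'; ring.
rewrite !normrM ler_wpM2l// [leRHS]ger0_norm ?addr_ge0 ?halfchord_ge0//.
by rewrite gtr0_norm// lerDr halfchord_ge0.
Qed.

End sqrt_chord.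

Section disc_integral.
Variable R : realType.
Notation mu := (@lebesgue_measure R).
Local Notation plane := (measurableTypeR R * measurableTypeR R)%type.

Variables (b : bool) (c : R * R) (rho : R) (g : R * R -> R) (L : R).
Hypotheses (rho0 : 0 <= rho) (L0 : 0 <= L) (gL : lip L g).

Local Notation f := (on_disc b c rho g).
Let B := `|g c| + L * rho.

Lemma in_disc_le z : in_disc b c rho z -> dotp (z - c) (z - c) <= rho ^+ 2.
Proof. by rewrite /in_disc; case: b => //= /ltW. Qed.

Lemma notin_disc_ge z : ~~ in_disc b c rho z -> rho ^+ 2 <= dotp (z - c) (z - c).
Proof. by rewrite /in_disc; case: b => //=; rewrite -?ltNge -?leNgt// => /ltW. Qed.

Lemma disc_bound z : in_disc b c rho z -> `|g z| <= B.
Proof.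
move=> /in_disc_le /(norm_le_dotp rho0) zc.
have -> : g z = g c + (g z - g c) by ring.
rewrite (le_trans (ler_normD _ _))// /B lerD2l (le_trans (gL _ _))//.
by rewrite ler_wpM2l.
Qed.

Lemma disc_bound_ge0 : 0 <= B. Proof. by rewrite addr_ge0// mulr_ge0. Qed.

Lemma on_disc_bounded z : `|f z| <= B.
Proof.
by rewrite /on_disc; case: ifPn => [/disc_bound//|_]; rewrite normr0 disc_bound_ge0.
Qed.

Lemma on_disc_supp z : 2 * rho ^+ 2 + 2 * dotp c c < dotp z z -> f z = 0.
Proof.
move=> zb; rewrite /on_disc; case: ifPn => // /in_disc_le zc.
suff : dotp z z <= 2 * rho ^+ 2 + 2 * dotp c c by rewrite leNgt zb.
(* In Euclidean norms, 2 |z - c|^2 + 2 |c|^2 - |z|^2 = |z - 2 c|^2. *)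
have := sqr_ge0 (z.1 - 2 * c.1); have := sqr_ge0 (z.2 - 2 * c.2).
move: zc; rewrite /dotp/= -!expr2; lra.
Qed.

Lemma measurable_on_disc : measurable_fun setT (f : plane -> R).
Proof.
apply: measurable_fun_ifT => //; last first.
  by apply: continuous_measurable_plane; exact: lip_continuous gL.
have mdist : measurable_fun setT (fun z : plane => dotp (z - c) (z - c) : R).
  apply: measurable_funD; apply: measurable_funM; apply: measurable_funD => //.
rewrite /in_disc; case: b => /=.
  exact: measurable_fun_ler.
exact: measurable_fun_ltr.
Qed.

Variable th : R * R.
Hypothesis th1 : enorm th = 1.

Let sigma := dotp th c.
Let tau := dotp (perp th) c.

Lemma rot_dotp : rot th (sigma, tau) = c.
Proof.
have th1' := enorm1_dotp th1.
rewrite rotE [RHS]surjective_pairing /sigma /tau /dotp/=; congr pair.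
  rewrite -[RHS]mulr1 -th1' /dotp; ring.
rewrite -[RHS]mulr1 -th1' /dotp; ring.
Qed.

Lemma dist_rot s t : dotp (rot th (s, t) - c) (rot th (s, t) - c) =
  (s - sigma) ^+ 2 + (t - tau) ^+ 2.
Proof.
rewrite -[in LHS]rot_dotp -(dotp_rot2 (s - sigma, t - tau) th1).
by congr dotp; rewrite !rotE/=; apply: injective_projections => /=; ring.
Qed.

Lemma in_disc_rot s t : in_disc b c rho (rot th (s, t)) ->
  `|t - tau| <= halfchord rho (s - sigma).
Proof. by move=> /in_disc_le; rewrite dist_rot => /halfchord_leP. Qed.

Lemma notin_disc_rot s t : ~~ in_disc b c rho (rot th (s, t)) ->
  halfchord rho (s - sigma) <= `|t - tau|.
Proof. by move=> /notin_disc_ge; rewrite dist_rot => /halfchord_geP. Qed.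

Lemma norm_rot_le x y : `|rot th x - rot th y| <= `|x.1 - y.1| + `|x.2 - y.2|.
Proof.
have [t1 t2] := norm_component_le th1.
have bnd p q (v w : R) : `|v| <= 1 -> `|w| <= 1 -> `|p * v + q * w| <= `|p| + `|q| :> R.
  move=> v1 w1; rewrite (le_trans (ler_normD _ _))// !normrM lerD//.
    by rewrite ler_piMr.
  by rewrite ler_piMr.
rewrite !rotE norm_pair_le/=; apply/andP; split.
  rewrite (_ : _ - _ = (x.1 - y.1) * th.1 + (x.2 - y.2) * (- th.2)); last by ring.
  by apply: bnd => //; rewrite normrN.
rewrite (_ : _ - _ = (x.1 - y.1) * th.2 + (x.2 - y.2) * th.1); last by ring.
exact: bnd.
Qed.

Definition chord_int s := \int[mu]_t (f (rot th (s, t))).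

Lemma chord_integrable s : mu.-integrable setT (EFin \o (fun t => f (rot th (s, t)))).
Proof.
exact: (line_integrable measurable_on_disc on_disc_bounded on_disc_supp).
Qed.

Local Notation w s := (halfchord rho (s - sigma)).

(** Both chords are centred at [tau]. Where they overlap, [g] changes by at most [L * |s - s'|]; on
    the two end pieces only the longer one contributes, with values at most [B]. *)
Lemma chord_int_dist s s' :
  `|chord_int s - chord_int s'| <= 2 * (L * `|s - s'|) * rho + 2 * B * `|w s - w s'|.
Proof.
rewrite /chord_int -RintegralB//; [|exact: chord_integrable..].
have -> : `|w s - w s'| = Num.max (w s) (w s') - Num.min (w s) (w s').
  by case: (leP (w s) (w s')) => [?|/ltW ?]; [rewrite distrC|]; rewrite ger0_norm ?subr_ge0.
apply: (@Rintegral_shell_le _ _ _ _ tau) => //.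
- by rewrite mulr_ge0.
- exact: disc_bound_ge0.
- by rewrite le_min !halfchord_ge0//= ge_min !le_max lexx.
- exact: (integrableB measurableT (chord_integrable s) (chord_integrable s')).
move=> t; rewrite /on_disc.
have Ls0 : 0 <= (if `|t - tau| <= rho then L * `|s - s'| else 0).
  by case: ifP => // _; rewrite mulr_ge0.
case: ifPn => [/[dup] ins /in_disc_rot ws|/[dup] nins /notin_disc_rot ws];
  case: ifPn => [/[dup] ins' /in_disc_rot ws'|/[dup] nins' /notin_disc_rot ws'].
- rewrite (le_trans ws (halfchord_le rho0 _)).
  apply: (@le_trans _ _ (L * `|s - s'|)); last first.
    by rewrite lerDl; case: ifP => // _; exact: disc_bound_ge0.
  rewrite (le_trans (gL _ _))// ler_wpM2l// (le_trans (norm_rot_le _ _))//=.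
  by rewrite subrr normr0 addr0.
- rewrite subr0 le_max ws/= ge_min ws' orbT/=.
  by rewrite (le_trans (disc_bound ins))// lerDr.
- rewrite sub0r normrN le_max ws' orbT/= ge_min ws/=.
  by rewrite (le_trans (disc_bound ins'))// lerDr.
- rewrite subrr normr0 addr_ge0//; case: ifP => // _; exact: disc_bound_ge0.
Qed.

Lemma chord_int_eq0 s : w s = 0 -> chord_int s = 0.
Proof.
move=> ws; apply/eqP; rewrite -normr_le0.
have -> : 0 = 2 * 0 * 0 + 2 * B * (0 - 0) by ring.
apply: (@Rintegral_shell_le _ _ _ _ tau) => //.
- exact: disc_bound_ge0.
- by rewrite lexx.
- exact: chord_integrable.
move=> t; rewrite /on_disc; case: ifPn => [/[dup] ins /in_disc_rot|_]; last first.
  rewrite normr0; apply: addr_ge0; case: ifP => // _; exact: disc_bound_ge0.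
rewrite ws => t0; rewrite t0 normr_ge0/= add0r; exact: disc_bound.
Qed.

(** The integrand is compared with the constant [g p], where [p] is the point of tangency; points of
    the chord are within [h + w] of [p]. *)
Lemma chord_int_near_tangent h : 0 <= h ->
  `|chord_int (sigma + rho - h) - 2 * w (sigma + rho - h) * g (c + rho *: th)| <=
  2 * w (sigma + rho - h) * (L * (h + w (sigma + rho - h))).
Proof.
move=> h0; set s := sigma + rho - h; set p := c + rho *: th.
have pE : p = rot th (sigma + rho, tau).
  have := rot_dotp; rewrite !rotE => E.
  have /= E1 := congr1 fst E; have /= E2 := congr1 snd E.
  apply: injective_projections => /=; [rewrite -[LHS]/(c.1 + rho * th.1) -E1|
    rewrite -[LHS]/(c.2 + rho * th.2) -E2]; ring.
have ws0 : 0 <= w s by exact: halfchord_ge0.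
pose E : set R := `[tau - w s, tau + w s]%classic.
have iE : mu.-integrable setT (EFin \o (fun t => g p * (\1_E t : R))).
  apply: (@integrableZl _ _ _ mu setT measurableT _ (EFin \o \1_E)).
  exact: integrable_indic_itv.
have -> : 2 * w s * g p = \int[mu]_t (g p * \1_E t).
  rewrite RintegralZl//; last exact: integrable_indic_itv.
  rewrite Rintegral_indic_itv; first by ring.
  by lra.
rewrite /chord_int -RintegralB//; last exact: chord_integrable.
(* The second term, a shell of zero width, takes care of the end points of the chord, which an open
   disc does not contain. *)
have -> : 2 * w s * (L * (h + w s)) =
    2 * (L * (h + w s)) * w s + 2 * `|g p| * (w s - w s) by ring.
apply: (@Rintegral_shell_le _ _ _ _ tau) => //.
- by rewrite mulr_ge0// addr_ge0.
- by rewrite ws0 lexx.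
- exact: (integrableB measurableT (chord_integrable s) iE).
move=> t; have -> : \1_E t = (if `|t - tau| <= w s then 1 else 0) :> R.
  by rewrite indicE mem_setE in_itv/= -ler_distl; case: ifP.
rewrite /on_disc; case: ifPn => [/in_disc_rot tw|/notin_disc_rot wt].
  rewrite tw mulr1.
  apply: (@le_trans _ _ (L * (h + w s))); last by rewrite lerDl; case: ifP.
  rewrite (le_trans (gL _ _))// ler_wpM2l// pE (le_trans (norm_rot_le _ _))//= lerD//.
  rewrite /s (_ : _ - _ = - h); last by ring.
  by rewrite normrN ger0_norm.
rewrite sub0r normrN wt/=; case: ifPn => tw; last by rewrite mulr0 normr0 add0r.
by rewrite mulr1 lerDr mulr_ge0// addr_ge0.
Qed.

End disc_integral.

(** * Tangent lines *)

Lemma sum_left_lip (R : realType) (I : eqType) (r : seq I) (P : pred I)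
    (G : I -> R -> R) (s0 : R) :
  (forall j, P j -> exists K h0 : R, [/\ 0 <= K, 0 < h0 &
    forall h, 0 <= h -> h <= h0 -> `|G j (s0 - h) - G j s0| <= K * h]) ->
  exists K h0 : R, [/\ 0 <= K, 0 < h0 & forall h, 0 <= h -> h <= h0 ->
    `|\sum_(j <- r | P j) G j (s0 - h) - \sum_(j <- r | P j) G j s0| <= K * h].
Proof.
move=> GP; elim: r => [|j r [K [h0 [K0 h00 IH]]]].
  by exists 0, 1; split => // h _ _; rewrite !big_nil subrr normr0 mul0r.
have [Pj|Pj] := boolP (P j); last first.
  by exists K, h0; split => // h hh0 hh; rewrite !big_cons (negbTE Pj); exact: IH.
have [K' [h0' [K'0 h0'0 GPj]]] := GP j Pj.
exists (K' + K), (Num.min h0' h0); split; first exact: addr_ge0.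
  by rewrite lt_min h0'0.
move=> h hh; rewrite le_min => /andP[h1 h2]; rewrite !big_cons Pj mulrDl.
by rewrite opprD addrACA (le_trans (ler_normD _ _))// lerD// ?GPj ?IH.
Qed.

Section detection.
Variable R : realType.
Notation mu := (@lebesgue_measure R).
Notation mu2 := (mu \x mu)%E.
Local Notation plane := (measurableTypeR R * measurableTypeR R)%type.

Lemma chord_int_continuous b (c : R * R) rho g L th :
  0 <= rho -> 0 <= L -> lip L g -> enorm th = 1 ->
  continuous (chord_int b c rho g th).
Proof.
move=> rho0 L0 gL th1 s; apply/cvgrPdist_lt => e e0.
pose bnd s' := 2 * (L * `|s - s'|) * rho + 2 * (`|g c| + L * rho) *
  `|halfchord rho (s - dotp th c) - halfchord rho (s' - dotp th c)|.
have cid : (fun s' : R => s') x @[x --> s] --> s by exact: cvg_id.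
have cbnd : bnd x @[x --> s] --> bnd s.
  apply: cvgD.
    apply: cvgMl; apply: cvgMr; apply: cvgMr; apply: cvg_norm.
    by apply: cvgB => //; exact: cvg_cst.
  apply: cvgMr; apply: cvg_norm; apply: cvgB; first exact: cvg_cst.
  apply: (@continuous_comp _ _ _ (fun s' => s' - dotp th c) (halfchord rho)).
    by apply: cvgB => //; exact: cvg_cst.
  exact: halfchord_continuous.
have := cbnd; move/cvgrPdist_lt/(_ _ e0); apply: filterS => s'.
rewrite {1}/bnd !subrr normr0 !mulr0 mul0r addr0 sub0r normrN => H.
apply: le_lt_trans (chord_int_dist b c rho0 L0 gL th1 s s') _.
exact: le_lt_trans (ler_norm _) H.
Qed.

Lemma chord_int_left_lip b (c : R * R) rho g L th s :
  0 <= rho -> 0 <= L -> lip L g -> enorm th = 1 -> s != dotp th c + rho ->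
  exists K h0 : R, [/\ 0 <= K, 0 < h0 & forall h, 0 <= h -> h <= h0 ->
    `|chord_int b c rho g th (s - h) - chord_int b c rho g th s| <= K * h].
Proof.
move=> rho0 L0 gL th1 sc.
have sr : s - dotp th c != rho by rewrite subr_eq addrC.
have [K [h0 [K0 h00 wK]]] := halfchord_left_lip rho0 sr.
have B0 : 0 <= `|g c| + L * rho by rewrite addr_ge0// mulr_ge0.
exists (2 * L * rho + 2 * (`|g c| + L * rho) * K), h0; split => //.
  by rewrite addr_ge0// !mulr_ge0.
move=> h hh0 hh; apply: le_trans (chord_int_dist b c rho0 L0 gL th1 (s - h) s) _.
rewrite (_ : s - h - s = - h); last by ring.
rewrite normrN ger0_norm// [leRHS]mulrDl; apply: lerD.
  by rewrite le_eqVlt; apply/orP; left; apply/eqP; ring.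
rewrite -[leRHS]mulrA; apply: ler_wpM2l; first by rewrite mulr_ge0.
by rewrite (_ : s - h - _ = s - dotp th c - h) ?wK//; ring.
Qed.

Variables (I : finType) (b : I -> bool) (c : I -> R * R) (rho : I -> R).
Variables (g : I -> R * R -> R) (L : R).
Hypotheses (rho0 : forall i, 0 <= rho i) (L0 : 0 <= L) (gL : forall i, lip L (g i)).

Let f i := on_disc (b i) (c i) (rho i) (g i).
Let H y := \sum_i f i y.

Lemma measurable_sum_discs : measurable_fun setT (H : plane -> R).
Proof.
apply: measurable_sum => i; exact: measurable_on_disc (gL i).
Qed.

Let A := \sum_i (2 * rho i ^+ 2 + 2 * dotp (c i) (c i)).
Let B := \sum_i (`|g i (c i)| + L * rho i).

Lemma sum_discs_bounded z : `|H z| <= B.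
Proof.
rewrite (le_trans (ler_norm_sum _ _ _))//; apply: ler_sum => i _.
exact: on_disc_bounded.
Qed.

Lemma sum_discs_supp z : A < dotp z z -> H z = 0.
Proof.
move=> Az; rewrite /H big1// => i _; apply: on_disc_supp => //.
apply: le_lt_trans Az; rewrite /A (bigD1 i)//= lerDl sumr_ge0// => j _.
by rewrite addr_ge0 ?mulr_ge0 ?sqr_ge0// /dotp addr_ge0// -expr2 sqr_ge0.
Qed.

Variable th : R * R.
Hypothesis th1 : enorm th = 1.

Let G i := chord_int (b i) (c i) (rho i) (g i) th.

Lemma sum_discs_line s : \int[mu]_t (H (rot th (s, t))) = \sum_i G i s.
Proof.
rewrite /H; set r := index_enum I.
suff [] : mu.-integrable setT (EFin \o (fun t => \sum_(i <- r) f i (rot th (s, t)))) /\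
    \int[mu]_t (\sum_(i <- r) f i (rot th (s, t))) = \sum_(i <- r) G i s by [].
have iG i : mu.-integrable setT (EFin \o (fun t => f i (rot th (s, t)))).
  exact: (chord_integrable (b i) (c i) (rho0 i) L0 (gL i) th1 s).
elim: r => [|i r [IH1 IH2]].
  split; last by under eq_Rintegral do rewrite big_nil; rewrite Rintegral_cst// mul0r big_nil.
  by under [X in _ \o X]eq_fun do rewrite big_nil; exact: integrable0.
under [X in _ \o X]eq_fun do rewrite big_cons.
split; first exact: (integrableD measurableT (iG i) IH1).
under eq_Rintegral do rewrite big_cons.
by rewrite RintegralD// IH2 big_cons.
Qed.

Variables (kmin kmax : R) (kk : kmin < kmax).
Hypothesis Hcos : forall k beta : R, kmin < k < kmax ->
  \int[mu2]_y (cos (k * dotp th y + beta) * H y) = 0.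

(** By [integral_rot], [Hcos] says that the cosine transform of this continuous, compactly supported
    sum vanishes on [(kmin, kmax)]. *)
Lemma sum_chord_int_eq0 s : \sum_i G i s = 0.
Proof.
apply: (@cos_transform_inj R (`|A| + 1) kmin kmax (fun s => \sum_i G i s)) => //.
  split.
    apply: (@continuous_big _ _ +%R 0 xpredT) => [|i _]; first exact: add_continuous.
    exact: (chord_int_continuous (rho0 i) L0 (gL i) th1).
  move=> x Ax; rewrite -sum_discs_line.
  under eq_Rintegral => t _.
    rewrite sum_discs_supp; first over.
    rewrite dotp_rot2//=.
    by rewrite (lt_le_trans (lt_sqr_norm Ax))// lerDl sqr_ge0.
  by rewrite Rintegral_cst// mul0r.
move=> k beta kP; rewrite -[RHS](Hcos beta kP).
rewrite (integral_rot measurable_sum_discs sum_discs_bounded sum_discs_supp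
  (phi := fun x => cos (k * x + beta)) (C := 1))//.
- by apply: eq_Rintegral => x _; rewrite sum_discs_line.
- by apply: continuous_measurable_fun; exact: continuous_cos_affine.
- by move=> x; exact: cos_max.
Qed.

(* The chord integrals of the other discs are Lipschitz to the left of the
   tangent line, whereas that of disc [i0] has there a square root singularity
   with coefficient proportional to the value at the point of tangency. *)
Lemma tangent_value_eq0 i0 : 0 < rho i0 ->
  (forall j, j != i0 -> dotp th (c j) + rho j != dotp th (c i0) + rho i0) ->
  g i0 (c i0 + rho i0 *: th) = 0.
Proof.
move=> r0 sep; set s0 := dotp th (c i0) + rho i0 in sep.
have [K [h0 [K0 h00 KP]]] : exists K h0 : R, [/\ 0 <= K, 0 < h0 &
    forall h, 0 <= h -> h <= h0 -> `|\sum_(j | j != i0) G j (s0 - h) -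
       \sum_(j | j != i0) G j s0| <= K * h].
  apply: sum_left_lip => j /sep; rewrite eq_sym.
  exact: (chord_int_left_lip (b j) (rho0 j) L0 (gL j) th1).
have G0 : G i0 s0 = 0.
  apply: (chord_int_eq0 (b i0) (rho0 i0) L0 (gL i0) th1).
  rewrite /s0 addrC addKr; apply: halfchord_eq0; first exact: rho0.
  by rewrite ger0_norm.
(* The chord integrals sum to 0 at [s0] and at [s0 - h], and [G i0 s0 = 0]; so [G i0 (s0 - h)] is
   minus the increment of the other discs. *)
have GK h : 0 <= h -> h <= h0 -> `|G i0 (s0 - h)| <= K * h.
  move=> hh0 hh; have := KP h hh0 hh.
  have := sum_chord_int_eq0 (s0 - h); have := sum_chord_int_eq0 s0.
  rewrite (bigD1 i0)//= G0 add0r => ->.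
  by rewrite (bigD1 i0)//= => /eqP; rewrite addr_eq0 => /eqP ->; rewrite subr0 normrN.
set p := _ + _; apply/eqP/negPn/negP => gp0.
have {}gp0 : 0 < `|g i0 p| by rewrite normr_gt0.
(* With [h <= w] and [h <= w ^+ 2 / rho i0], the bound [GK] and the expansion at the tangent line
   combine into [2 * |g i0 p| <= C * w]. As [w ^+ 2 <= 2 * rho i0 * h], the last term in the choice
   of [h] contradicts this. *)
pose C := 4 * L + K / rho i0.
have C0 : 0 <= C by apply: addr_ge0; [rewrite mulr_ge0|rewrite divr_ge0// ltW].
pose h := Num.min (Num.min h0 (rho i0)) (`|g i0 p| ^+ 2 / (rho i0 * (C ^+ 2 + 1))).
have C1 : 0 < C ^+ 2 + 1 by rewrite ltr_wpDl// sqr_ge0.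
have hgt0 : 0 < h by rewrite !lt_min h00 r0 divr_gt0 ?mulr_gt0 ?exprn_gt0.
have hh0 : h <= h0 by rewrite /h !ge_min lexx.
have hr : h <= rho i0 by rewrite /h !ge_min lexx orbT.
have hg : h * (rho i0 * (C ^+ 2 + 1)) <= `|g i0 p| ^+ 2.
  by rewrite -ler_pdivlMr ?mulr_gt0// /h ge_min lexx orbT.
have := chord_int_near_tangent (b i0) (c i0) (rho0 i0) L0 (gL i0) th1 (ltW hgt0).
rewrite -/s0 -/p -/(G i0 _) (_ : s0 - h - _ = rho i0 - h); last by rewrite /s0; ring.
set w := halfchord _ _ => tangent.
have w2 : w ^+ 2 = 2 * rho i0 * h - h ^+ 2.
  rewrite sqr_sqrtr; first by ring.
  rewrite subr_sqr mulr_ge0//; lra.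
have hw : h <= w.
  have := halfchord_geP (rho := rho i0) (u := rho i0 - h) (v := h).
  rewrite -[h <= w]ler_sqr ?nnegrE ?(ltW hgt0) ?halfchord_ge0// w2 => _.
  have : h * h <= h * rho i0 by rewrite ler_pM2l.
  rewrite -expr2; lra.
have w0 : 0 < w := lt_le_trans hgt0 hw.
have hwr : h * rho i0 <= w ^+ 2.
  rewrite w2; have : h * h <= h * rho i0 by rewrite ler_pM2l.
  rewrite -expr2; lra.
have gCw : 2 * `|g i0 p| <= C * w.
  rewrite -(ler_pM2r w0).
  have Gh := GK _ (ltW hgt0) hh0.
  have Gg : `|2 * w * g i0 p| <= 2 * w * (L * (h + w)) + K * h.
    have -> : 2 * w * g i0 p = G i0 (s0 - h) - (G i0 (s0 - h) - 2 * w * g i0 p) by ring.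
    by rewrite (le_trans (ler_normB _ _))// addrC lerD.
  move: Gg; rewrite normrM ger0_norm ?mulr_ge0 ?(ltW w0)// => Gg.
  rewrite (_ : 2 * _ * w = 2 * w * `|g i0 p|); last by ring.
  apply: le_trans Gg _; rewrite /C.
  have -> : (4 * L + K / rho i0) * w * w =
     2 * w * (L * (w + w)) + K * (w ^+ 2 / rho i0).
    by field; rewrite gt_eqF.
  apply: lerD; last by rewrite ler_wpM2l// ler_pdivlMr.
  by rewrite ler_wpM2l ?mulr_ge0 ?(ltW w0)// ler_wpM2l// lerD2r.
have : (2 * `|g i0 p|) ^+ 2 <= (C * w) ^+ 2.
  by rewrite ler_sqr ?nnegrE ?mulr_ge0// ltW.
rewrite !exprMn w2.
have : C ^+ 2 * (2 * rho i0 * h - h ^+ 2) <= C ^+ 2 * (2 * rho i0 * h).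
  by rewrite ler_wpM2l ?sqr_ge0// gerBl sqr_ge0.
have rh : 0 < rho i0 * h by rewrite mulr_gt0.
have g2 : 0 < `|g i0 p| ^+ 2 by rewrite exprn_gt0.
have := hg; rewrite !mulrDr; lra.
Qed.

End detection.

(** * Lipschitz functions on an annulus *)

Lemma min_shift_bounds (R : realDomainType) (x y d z : R) :
  - d <= x - y -> x - y <= d -> z = Num.min x y - 2 * d ->
  [/\ z <= x - 2 * d, z <= y - 2 * d, x - 3 * d <= z & y - 3 * d <= z].
Proof. by move=> ? ? ->; have [?|?] := leP x y; split; lra. Qed.

Lemma max_shift_bounds (R : realDomainType) (x y d z : R) :
  - d <= x - y -> x - y <= d -> z = Num.max x y + 2 * d ->
  [/\ x + 2 * d <= z, y + 2 * d <= z, z <= x + 3 * d & z <= y + 3 * d].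
Proof. by move=> ? ? ->; have [?|?] := leP x y; split; lra. Qed.

Lemma between_le (R : realDomainType) (x y t : R) : x <= y ->
  Num.min x y < t < Num.max x y -> x < t /\ t < y.
Proof. by move=> xy; rewrite min_l// max_r// => /andP. Qed.

Lemma between_ge (R : realDomainType) (x y t : R) : y <= x ->
  Num.min x y < t < Num.max x y -> y < t /\ t < x.
Proof. by move=> xy; rewrite min_r// max_l// => /andP. Qed.

Lemma between_dist (R : realDomainType) (x y t d : R) :
  `|x - y| <= d -> Num.min y x < t < Num.max y x -> `|t - x| <= d.
Proof.
rewrite !ler_norml => /andP[? ?]; have [yx|/ltW xy] := leP y x => /andP[? ?].
  by apply/andP; split; lra.
by apply/andP; split; lra.
Qed.

Lemma sqr_up (R : realDomainType) (x d q : R) :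
  0 <= d -> `|q - x| <= d -> q ^+ 2 <= (`|x| + d) ^+ 2.
Proof.
move=> d0 qx; rewrite -[q ^+ 2]real_normK ?num_real// ler_sqr ?nnegrE ?addr_ge0//.
by rewrite (_ : q = x + (q - x)) ?(le_trans (ler_normD _ _)) ?lerD2l//; ring.
Qed.

Lemma sqr_lo (R : realDomainType) (x d q : R) :
  0 <= d -> `|q - x| <= d -> x ^+ 2 - 2 * d * `|x| <= q ^+ 2.
Proof.
move=> d0 qx; have q0 := sqr_ge0 q; have x0 := normr_ge0 x.
rewrite -[x ^+ 2]real_normK ?num_real//.
have xq : `|x| - d <= `|q| by have := lerB_dist x q; rewrite distrC; lra.
have [xd|xd] := leP (`|x|) d.
  have : 0 <= `|x| * (d - `|x|) by rewrite mulr_ge0// subr_ge0.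
  have : 0 <= `|x| * d by rewrite mulr_ge0.
  lra.
have : (`|x| - d) ^+ 2 <= `|q| ^+ 2.
  by rewrite ler_sqr ?nnegrE// subr_ge0 ltW.
rewrite [X in _ <= X]real_normK ?num_real//.
by have := sqr_ge0 d; lra.
Qed.

Lemma sqr_half_le (R : realFieldType) (m x1 x2 : R) :
  0 <= m -> `|x2| <= x1 -> m ^+ 2 <= x1 ^+ 2 + x2 ^+ 2 -> m / 2 <= x1.
Proof.
move=> m0 x21 mx; have x10 : 0 <= x1 := le_trans (normr_ge0 _) x21.
rewrite -ler_sqr ?nnegrE ?divr_ge0//.
have : x2 ^+ 2 <= x1 ^+ 2 by rewrite -[x2 ^+ 2]real_normK ?num_real// ler_sqr ?nnegrE.
by rewrite expr_div_n; have := sqr_ge0 m; lra.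
Qed.

Section axis_paths.
Variables (R : realType) (r rr : R).
Implicit Types (h : R -> R -> R) (a y t d : R).

Definition in_ring a y : Prop := r ^+ 2 <= a ^+ 2 + y ^+ 2 <= rr ^+ 2.
(* If [r = 0] the ring is a disc, whose centre is an interior point. *)
Definition in_open_ring a y : Prop :=
  (r = 0 \/ r ^+ 2 < a ^+ 2 + y ^+ 2) /\ a ^+ 2 + y ^+ 2 < rr ^+ 2.

Lemma in_open_ringW a y : in_open_ring a y -> in_ring a y.
Proof.
move=> [ra ar]; rewrite /in_ring (ltW ar) andbT; case: ra => [->|/ltW//].
by rewrite expr0n addr_ge0 ?sqr_ge0.
Qed.

(** The end points may lie on the boundary circles; the points between them must be interior, where
    partial derivatives are available. *)
Definition horiz_lip (B : R) h := forall y a1 a2, a1 <= a2 ->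
  in_ring a1 y -> in_ring a2 y -> (forall t, a1 < t < a2 -> in_open_ring t y) ->
  `|h a2 y - h a1 y| <= B * (a2 - a1).

Definition vert_lip (B : R) h := horiz_lip B (fun a y => h y a).

Lemma horiz_lip_le B h y a1 a2 : horiz_lip B h ->
  in_ring a1 y -> in_ring a2 y ->
  (forall t, Num.min a1 a2 < t < Num.max a1 a2 -> in_open_ring t y) ->
  `|h a2 y - h a1 y| <= B * `|a2 - a1|.
Proof.
move=> hh i1 i2; have [a12|/ltW a21] := leP a1 a2.
  by rewrite [X in _ * X]ger0_norm ?subr_ge0// => io; exact: hh.
by rewrite distrC [X in _ * X]distrC [X in _ * X]ger0_norm ?subr_ge0// => io; exact: hh.
Qed.

Local Notation m := ((r + rr) / 2).

(* Two nearby points are joined by three axis-parallel segments: away from the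
   nearer boundary circle, across at [z], and back. *)
Lemma ring_lip_sector B h d x1 x2 y1 y2 : 0 <= r -> r < rr -> 0 <= B ->
  horiz_lip B h -> vert_lip B h ->
  0 < d -> d <= m / 8 -> 8 * d * rr < m ^+ 2 - r ^+ 2 ->
  18 * d * rr < rr ^+ 2 - m ^+ 2 -> r = 0 \/ d <= r / 4 ->
  `|x2| <= x1 -> in_ring x1 x2 -> in_ring y1 y2 ->
  `|x1 - y1| <= d -> `|x2 - y2| <= d ->
  `|h x1 x2 - h y1 y2| <= 7 * B * d.
Proof.
move=> r0 rrr B0 hh hv d0 dm dm1 dm2 dr x21 xin yin.
move=> xy1 xy2; move: (xy1) (xy2); rewrite [in X in X -> _]ler_norml => /andP[xy1l xy1r].
rewrite [in X in X -> _]ler_norml => /andP[xy2l xy2r].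
have x10 : 0 <= x1 := le_trans (normr_ge0 _) x21.
have rr0 : 0 < rr by exact: le_lt_trans rrr.
have m0 : 0 < m by move: r0 rr0; clear; lra.
have mrr : m < rr by move: rrr; clear; lra.
have x1rr : x1 <= rr.
  rewrite -ler_sqr ?nnegrE ?(ltW rr0)//; case/andP: xin => _.
  by have := sqr_ge0 x2; clear; lra.
have x2sq : `|x2| ^+ 2 = x2 ^+ 2 by rewrite real_normK ?num_real.
have x20 := normr_ge0 x2.
have q_up q : `|q - x2| <= d -> q ^+ 2 <= (`|x2| + d) ^+ 2 := sqr_up (ltW d0).
have q_lo q : `|q - x2| <= d -> x2 ^+ 2 - 2 * d * `|x2| <= q ^+ 2 := sqr_lo (ltW d0).
have y2q : `|y2 - x2| <= d by rewrite distrC ler_norml xy2l xy2r.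
have x2q : `|x2 - x2| <= d by rewrite subrr normr0 ltW.
suff [z [[zx zy ix iy] [ox oy oz]]] : exists z,
   [/\ `|x1 - z| <= 3 * d, `|z - y1| <= 3 * d,
   in_open_ring z x2 & in_open_ring z y2] /\
   [/\ forall t, Num.min z x1 < t < Num.max z x1 -> in_open_ring t x2,
   forall t, Num.min y1 z < t < Num.max y1 z -> in_open_ring t y2 &
   forall q, `|q - x2| <= d -> in_open_ring z q].
  have -> : h x1 x2 - h y1 y2 = (h x1 x2 - h z x2) + (h z x2 - h z y2) +
     (h z y2 - h y1 y2) by ring.
  have -> : 7 * B * d = B * (3 * d) + B * d + B * (3 * d) by ring.
  rewrite (le_trans (ler_normD _ _))// lerD//.
    rewrite (le_trans (ler_normD _ _))// lerD//.
      rewrite (le_trans (horiz_lip_le hh (in_open_ringW ix) xin ox))//.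
      by rewrite ler_wpM2l.
    have := @horiz_lip_le B (fun a y => h y a) z y2 x2 hv.
    rewrite /in_ring/in_open_ring ![_ + z ^+ 2]addrC => H.
    rewrite (le_trans (H _ _ _))//.
    + exact: in_open_ringW.
    + exact: in_open_ringW.
    + move=> t tt; rewrite addrC; apply: oz; exact: between_dist tt.
    + by rewrite ler_wpM2l.
  rewrite (le_trans (horiz_lip_le hh yin (in_open_ringW iy) oy))//.
  by rewrite ler_wpM2l.
have dx1 : 0 <= d * x1 by rewrite mulr_ge0// ltW.
have dx2 : 0 <= d * `|x2| by rewrite mulr_ge0// ltW.
have dx12 : d * `|x2| <= d * x1 by rewrite ler_pM2l.
have dx1r : d * x1 <= d * rr by rewrite ler_pM2l.
have d2 : 0 < d ^+ 2 by rewrite exprn_gt0.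
have drr : d <= rr by move: dm mrr m0; clear; lra.
have d2r : d ^+ 2 <= d * rr by rewrite expr2 ler_pM2l.
(* Beyond the middle radius [m] the path goes left, towards the centre; otherwise it goes right. The
   shift by [2 * d] makes room for the vertical move of length at most [d]. *)
have [xm|xm] := leP (m ^+ 2) (x1 ^+ 2 + x2 ^+ 2).
  have x1m : m / 2 <= x1 by exact: sqr_half_le (ltW m0) x21 xm.
  pose z := Num.min x1 y1 - 2 * d.
  have [zx zy z3 z4] := min_shift_bounds xy1l xy1r (erefl z).
  have x13 : 0 <= x1 - 3 * d by move: dm x1m m0; clear; lra.
  have z0 : 0 <= z := le_trans x13 z3.
  have zx1 : z <= x1 by move: zx d0; clear; lra.
  have zy1 : z <= y1 by move: zy d0; clear; lra.
  have t_lo t q : z <= t -> `|q - x2| <= d -> r ^+ 2 < t ^+ 2 + q ^+ 2.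
    move=> zt /q_lo qx.
    have : (x1 - 3 * d) ^+ 2 <= t ^+ 2.
      by rewrite ler_sqr ?nnegrE// ?(le_trans z3)// (le_trans z0).
    by move: qx xm dx12 dx1r dm1 d2; clear; lra.
  have t_x t : z <= t -> t < x1 -> in_open_ring t x2.
    move=> zt tx; split; first by right; exact: t_lo.
    case/andP: xin => _; apply: lt_le_trans; rewrite ltrD2r ltr_sqr ?nnegrE//.
    exact: le_trans zt.
  have t_y t : z <= t -> t < y1 -> in_open_ring t y2.
    move=> zt ty; split; first by right; exact: t_lo.
    have t0 : 0 <= t := le_trans z0 zt.
    case/andP: yin => _; apply: lt_le_trans; rewrite ltrD2r ltr_sqr ?nnegrE//.
    exact: le_trans (ltW ty).
  exists z; split; split.
  - by rewrite ger0_norm ?subr_ge0//; move: z3; clear; lra.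
  - by rewrite distrC ger0_norm ?subr_ge0//; move: z4; clear; lra.
  - by apply: t_x => //; move: zx d0; clear; lra.
  - by apply: t_y => //; move: zy d0; clear; lra.
  - by move=> t /(between_le zx1)[zt tx]; exact: t_x (ltW zt) tx.
  - by move=> t /(between_ge zy1)[zt tx]; exact: t_y (ltW zt) tx.
  - move=> q qx; split; first by right; exact: t_lo.
    have := q_up q qx; case/andP: xin => _.
    have : z ^+ 2 <= (x1 - 2 * d) ^+ 2 by rewrite ler_sqr ?nnegrE// (le_trans z0).
    have : d * (5 * d) < d * (2 * x1).
      by rewrite ltr_pM2l//; move: dm x1m m0 d0; clear; lra.
    by move: dx12 x2sq; clear; lra.
(* Moving right takes the second point away from the inner circle only if its abscissa is
   nonnegative. For [r > 0] this follows from [x1 >= r / 2] and [d <= r / 4]; for [r = 0] there is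
   no inner circle to avoid. *)
have y10 : r = 0 \/ 0 <= y1.
  case: dr => [|dr]; [by left|right].
  case/andP: xin => /(sqr_half_le r0 x21); move: dr xy1r r0; clear; lra.
pose z := Num.max x1 y1 + 2 * d.
have [zx zy z3 z4] := max_shift_bounds xy1l xy1r (erefl z).
have zx1 : x1 <= z by move: zx d0; clear; lra.
have zy1 : y1 <= z by move: zy d0; clear; lra.
have t_up t q : x1 - d <= t -> t <= z -> `|q - x2| <= d -> t ^+ 2 + q ^+ 2 < rr ^+ 2.
  move=> zt tz /q_up qx.
  have : t ^+ 2 <= (x1 + 3 * d) ^+ 2.
    rewrite -[t ^+ 2]real_normK ?num_real// ler_sqr ?nnegrE//; last first.
      by move: x10 d0; clear; lra.
    rewrite ler_norml; apply/andP; split; last exact: le_trans z3.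
    by move: zt x10 d0; clear; lra.
  by move: qx xm x2sq dx1r dx12 d2r dm2; clear; lra.
have t_x t : x1 < t -> t <= z -> in_open_ring t x2.
  move=> xt tz; split; last by apply: t_up => //; move: xt d0; clear; lra.
  right; case/andP: xin => + _; move=> /le_lt_trans; apply.
  by rewrite ltrD2r ltr_sqr ?nnegrE// (le_trans _ (ltW xt)).
have t_y t : y1 < t -> t <= z -> in_open_ring t y2.
  move=> yt tz; split; last by apply: t_up => //; move: yt xy1r d0; clear; lra.
  case: y10 => [->|y10]; [by left|right].
  case/andP: yin => + _; move=> /le_lt_trans; apply.
  by rewrite ltrD2r ltr_sqr ?nnegrE// (le_trans _ (ltW yt)).
exists z; split; split.
- by rewrite distrC ger0_norm ?subr_ge0//; move: z3; clear; lra.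
- by rewrite ger0_norm ?subr_ge0//; move: z4; clear; lra.
- by apply: t_x => //; move: zx d0; clear; lra.
- by apply: t_y => //; move: zy d0; clear; lra.
- by move=> t /(between_ge zx1)[zt tx]; exact: t_x zt (ltW tx).
- by move=> t /(between_le zy1)[zt tx]; exact: t_y zt (ltW tx).
- move=> q qx; split; last by apply: t_up => //; move: zx d0; clear; lra.
  right; have := q_lo q qx; case/andP: xin => + _.
  have : (x1 + 2 * d) ^+ 2 <= z ^+ 2.
    have : 0 <= x1 + 2 * d by move: x10 d0; clear; lra.
    by move=> x12; rewrite ler_sqr ?nnegrE// (le_trans x12).
  by move: dx12 dx1 d2; clear; lra.
Qed.

End axis_paths.

Section ring_symmetry.
Variables (R : realType) (r rr : R).
Hypotheses (r0 : 0 <= r) (rrr : r < rr).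
Implicit Types (h : R -> R -> R) (a y t d : R).

Lemma horiz_lip_opp1 B h :
  horiz_lip r rr B h -> horiz_lip r rr B (fun a y => h (- a) y).
Proof.
move=> hh y a1 a2 a12 i1 i2 io; rewrite distrC.
rewrite (_ : a2 - a1 = - a1 - - a2); last by ring.
apply: hh; rewrite /in_ring ?sqrrN ?lerN2// => t tt.
have := io (- t); rewrite /in_open_ring sqrrN; apply.
by case/andP: tt => ? ?; apply/andP; split; lra.
Qed.

Lemma vert_lip_opp1 B h :
  vert_lip r rr B h -> vert_lip r rr B (fun a y => h (- a) y).
Proof.
move=> hv y a1 a2 a12 i1 i2 io; apply: (hv (- y)) => //; rewrite /in_ring ?sqrrN//.
by move=> t /io; rewrite /in_open_ring sqrrN.
Qed.

Let m := (r + rr) / 2.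

(** Exchanging the coordinates and reflecting the first one bring the first point into the sector
    [|x2| <= x1] of [ring_lip_sector], where horizontal moves are within 45 degrees of radial
    ones. *)
Lemma ring_lip_local B h d x1 x2 y1 y2 : 0 <= B ->
  horiz_lip r rr B h -> vert_lip r rr B h ->
  0 < d -> d <= m / 8 -> 8 * d * rr < m ^+ 2 - r ^+ 2 ->
  18 * d * rr < rr ^+ 2 - m ^+ 2 -> r = 0 \/ d <= r / 4 ->
  in_ring r rr x1 x2 -> in_ring r rr y1 y2 ->
  `|x1 - y1| <= d -> `|x2 - y2| <= d ->
  `|h x1 x2 - h y1 y2| <= 7 * B * d.
Proof.
move=> B0 hh hv d0 d1 d2 d3 d4.
wlog x21 : h x1 x2 y1 y2 hh hv / `|x2| <= `|x1|.
  move=> wl ix iy xy1 xy2; have [x21|/ltW x12] := leP `|x2| `|x1|; first exact: wl.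
  by apply: (wl (fun a y => h y a)) => //; rewrite /in_ring addrC.
wlog x10 : h x1 y1 hh hv x21 / 0 <= x1.
  move=> wl ix iy xy1 xy2; have [x10|x10] := leP 0 x1; first exact: wl.
  have := wl (fun a y => h (- a) y) (- x1) (- y1).
  rewrite !opprK; apply; rewrite /in_ring ?sqrrN ?normrN//.
  - exact: horiz_lip_opp1.
  - exact: vert_lip_opp1.
  - by lra.
  - by rewrite addrC distrC.
rewrite (ger0_norm x10) in x21.
exact: ring_lip_sector r0 rrr B0 hh hv d0 d1 d2 d3 d4 x21.
Qed.

(** Points closer than some [delta] fall under [ring_lip_local]; for the others the trivial bound
    [2 * M] is at most [2 * M / delta] times the distance. *)
Lemma ring_lip B M h : 0 <= B -> 0 <= M ->
  horiz_lip r rr B h -> vert_lip r rr B h ->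
  (forall a y, in_ring r rr a y -> `|h a y| <= M) ->
  exists2 L, 0 <= L & forall x1 x2 y1 y2, in_ring r rr x1 x2 -> in_ring r rr y1 y2 ->
   `|h x1 x2 - h y1 y2| <= L * Num.max `|x1 - y1| `|x2 - y2|.
Proof.
move=> B0 M0 hh hv hM.
have rr0 : 0 < rr by exact: le_lt_trans rrr.
have m0 : 0 < m by rewrite /m; have := r0; lra.
have mrr : m < rr by rewrite /m; have := rrr; lra.
have rm : r < m by rewrite /m; have := rrr; lra.
have mr2 : 0 < m ^+ 2 - r ^+ 2 by rewrite subr_gt0 ltr_sqr ?nnegrE// ltW.
have rm2 : 0 < rr ^+ 2 - m ^+ 2 by rewrite subr_gt0 ltr_sqr ?nnegrE// ltW.
have [delta d0 [d1 d2 d3 d4]] : exists2 delta, 0 < delta &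
  [/\ delta <= m / 8, 8 * delta * rr < m ^+ 2 - r ^+ 2,
      18 * delta * rr < rr ^+ 2 - m ^+ 2 & (r = 0 \/ delta <= r / 4)].
  pose e := Num.min (m / 8) (Num.min ((m ^+ 2 - r ^+ 2) / (16 * rr))
    ((rr ^+ 2 - m ^+ 2) / (36 * rr))).
  have e0 : 0 < e.
    by rewrite !lt_min; apply/and3P; split; apply: divr_gt0 => //; apply: mulr_gt0.
  have e1 : e <= m / 8 by rewrite ge_min lexx.
  have e2 : e * (16 * rr) <= m ^+ 2 - r ^+ 2.
    by rewrite -ler_pdivlMr ?mulr_gt0// !ge_min lexx !orbT.
  have e3 : e * (36 * rr) <= rr ^+ 2 - m ^+ 2.
    by rewrite -ler_pdivlMr ?mulr_gt0// !ge_min lexx !orbT.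
  have [r_eq0|rn0] := eqVneq r 0.
    by exists e => //; split; [|lra|lra|left].
  have r_gt0 : 0 < r by rewrite lt_neqAle eq_sym rn0.
  exists (Num.min e (r / 4)); first by rewrite lt_min e0 divr_gt0.
  have el : Num.min e (r / 4) <= e by rewrite ge_min lexx.
  have elr : Num.min e (r / 4) * rr <= e * rr by rewrite ler_pM2r.
  split; [exact: le_trans e1|lra|lra|right].
  by rewrite ge_min lexx orbT.
exists (7 * B + 2 * M / delta).
  by rewrite addr_ge0 ?mulr_ge0 ?divr_ge0// ltW// invr_gt0.
move=> x1 x2 y1 y2 ix iy; set d := Num.max _ _.
have [x1d x2d] : `|x1 - y1| <= d /\ `|x2 - y2| <= d.
  by rewrite /d !le_max !lexx orbT.
have [dle|dgt] := leP d 0.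
  have -> : x1 = y1 by apply/eqP; rewrite -subr_eq0 -normr_le0 (le_trans x1d).
  have -> : x2 = y2 by apply/eqP; rewrite -subr_eq0 -normr_le0 (le_trans x2d).
  rewrite subrr normr0 mulr_ge0 ?addr_ge0 ?mulr_ge0//.
    by rewrite invr_ge0 ltW.
  by rewrite (le_trans _ x1d).
rewrite mulrDl; have [dd|dd] := leP d delta.
  have drr : d * rr <= delta * rr by rewrite ler_pM2r.
  apply: (@le_trans _ _ (7 * B * d)); last first.
    by rewrite lerDl !mulr_ge0 ?invr_ge0// ltW.
  apply: ring_lip_local => //.
  - exact: le_trans d1.
  - by lra.
  - by lra.
  - by case: d4 => [->|d4]; [left|right; exact: le_trans d4].
apply: (@le_trans _ _ (2 * M / delta * d)); last first.
  by rewrite lerDr !mulr_ge0// ltW.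
have -> : 2 * M / delta * d = 2 * M * (d / delta) by field; rewrite gt_eqF.
rewrite (le_trans (ler_normB _ _))//.
apply: (@le_trans _ _ (2 * M)).
  by have := hM _ _ ix; have := hM _ _ iy; lra.
by rewrite ler_peMr ?mulr_ge0// ler_pdivlMr// mul1r ltW.
Qed.

End ring_symmetry.

(** * Extension of Lipschitz functions to the plane *)

Section McShane.
Variable R : realType.

(** The extension is the infimum over [y] in [K] of the cones [h y + L * |x - y|]. *)
Lemma McShane_extension (K : set (R * R)) (h : R * R -> R) (L : R) : 0 <= L ->
  (forall x y, K x -> K y -> `|h x - h y| <= L * `|x - y|) ->
  exists2 g, lip L g & forall x, K x -> g x = h x.
Proof.
move=> L0 hL; have [->|/set0P[x0 Kx0]] := eqVneq K set0.
  by exists (cst 0) => // x y; rewrite subrr normr0 mulr_ge0.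
pose S x := [set h y + L * `|x - y| | y in K].
have S0 x : S x !=set0 by exists (h x0 + L * `|x - x0|); exists x0.
have Slb x z : K z -> lbound (S x) (h z - L * `|x - z|).
  move=> Kz _ [y Ky <-].
  have := hL z y Kz Ky; rewrite ler_norml => /andP[_ hzy].
  have : L * `|z - y| <= L * (`|x - z| + `|x - y|).
    by rewrite ler_wpM2l// [`|x - z|]distrC; exact: ler_distD.
  by lra.
have Shlb x : has_lbound (S x) by exists (h x0 - L * `|x - x0|); exact: Slb.
exists (fun x => inf (S x)); last first.
  move=> x Kx; apply/eqP; rewrite eq_le; apply/andP; split.
    by apply: ge_inf => //; exists x => //; rewrite subrr normr0 mulr0 addr0.
  have := Slb x x Kx; rewrite subrr normr0 mulr0 subr0 => ?.
  exact: lb_le_inf.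
have half x y : inf (S x) <= inf (S y) + L * `|x - y|.
  rewrite -lerBlDr; apply: lb_le_inf => // _ [z Kz <-]; rewrite lerBlDr.
  apply: (@le_trans _ _ (h z + L * `|x - z|)); first by apply: ge_inf => //; exists z.
  by rewrite -addrA lerD2l -mulrDr ler_wpM2l// [leRHS]addrC; exact: ler_distD.
move=> x y; rewrite ler_norml; have := half x y; have := half y x.
rewrite distrC => ? ?; apply/andP; split; lra.
Qed.

End McShane.

Section annulus_lip.
Variable R : realType.
Implicit Types (c z e p : R * R) (K : set (R * R)).

Lemma compact_continuous_bounded K (f : R * R -> R) : compact K ->
  {within K, continuous f} -> exists2 B, 0 <= B & forall z, K z -> `|f z| <= B.
Proof.
move=> cK cf; have /compact_bounded[B [_ BP]] := continuous_compact cf cK.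
exists (`|B| + 1); first by rewrite addr_ge0.
move=> z Kz; apply: (BP (`|B| + 1)); first by rewrite ltr_pwDr// ler_norm.
by exists z.
Qed.

Lemma is_derive_line p e (f : R * R -> R) (t d : R) :
  is_derive (p + t *: e) e f d -> is_derive t 1 (fun s => f (p + s *: e)) d.
Proof.
move=> [fd <-].
have E : (fun h : R => h^-1 *:
      (((fun s => f (p + s *: e)) \o shift t) (h *: 1) - f (p + t *: e))) =
    (fun h : R => h^-1 *: ((f \o shift (p + t *: e)) (h *: e) - f (p + t *: e))).
  apply/funext => h /=; congr (_ *: (f _ - _)).
  by rewrite scalerDl addrCA /GRing.scale/= mulr1.
split.
  by rewrite /derivable E.
by rewrite /derive E.
Qed.

Lemma within_continuous_line K p e (f : R * R -> R) (a b : R) :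
  {within K, continuous f} -> (forall t, t \in `[a, b] -> K (p + t *: e)) ->
  {within `[a, b], continuous (fun s => f (p + s *: e))}.
Proof.
move=> /subspace_continuousP cf Kab; apply/subspace_continuousP => t tab.
have ct : (fun s : R => p + s *: e) @ t --> p + t *: e.
  apply: cvgD; first exact: cvg_cst.
  exact: scalel_continuous.
move=> U /(cf _ (Kab _ tab)) fU.
apply: (@filterS _ (nbhs t) _ _ _ _ (ct _ fU)) => s /= KU sab.
by apply: KU; exact: Kab.
Qed.

Lemma line_lip K p e (f df : R * R -> R) (a b B : R) : a <= b ->
  {within K, continuous f} -> (forall t, a <= t <= b -> K (p + t *: e)) ->
  (forall t, a < t < b -> is_derive (p + t *: e) e f (df (p + t *: e))) ->
  (forall z, K z -> `|df z| <= B) ->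
  `|f (p + b *: e) - f (p + a *: e)| <= B * (b - a).
Proof.
move=> ab cf Kab dab dB.
have cline : {within `[a, b], continuous (fun s => f (p + s *: e))}.
  by apply: within_continuous_line cf _ => t; rewrite in_itv/=; exact: Kab.
have [t|t tab ->] := @MVT_segment R (fun s => f (p + s *: e))
   (fun s => df (p + s *: e)) a b ab _ cline.
  by rewrite in_itv/= => /dab; exact: is_derive_line.
rewrite normrM [X in _ * X]ger0_norm ?subr_ge0// ler_wpM2r ?subr_ge0//.
by apply: dB; apply: Kab; move: tab; rewrite in_itv.
Qed.

Lemma dotp_ge0 z : 0 <= dotp z z.
Proof. by rewrite addr_ge0// -expr2 sqr_ge0. Qed.

Lemma annulusP c (r rr : R) z : 0 <= r -> 0 <= rr ->
  annulus c r rr z <-> r ^+ 2 <= dotp (z - c) (z - c) <= rr ^+ 2.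
Proof.
move=> r0 rr0; rewrite /annulus/= /enorm.
rewrite -{1}[r]ger0_norm// -{1}[rr]ger0_norm// -!sqrtr_sqr.
by rewrite !ler_sqrt ?sqr_ge0 ?dotp_ge0.
Qed.

Lemma continuous_dist2 c : continuous (fun z => dotp (z - c) (z - c)).
Proof.
move=> z.
have c1 : (fun z : R * R => (z - c).1) @ z --> (z - c).1.
  by apply: cvgB; [exact: cvg_fst|exact: cvg_cst].
have c2 : (fun z : R * R => (z - c).2) @ z --> (z - c).2.
  by apply: cvgB; [exact: cvg_snd|exact: cvg_cst].
by apply: cvgD; apply: cvgM.
Qed.

Lemma annulus_closed c (r rr : R) : 0 <= r -> 0 <= rr -> closed (annulus c r rr).
Proof.
move=> r0 rr0.
have -> : annulus c r rr = (fun z => dotp (z - c) (z - c)) @^-1` `[r ^+ 2, rr ^+ 2]%classic.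
  by apply/seteqP; split => z; rewrite /= in_itv/=; move/(annulusP _ _ r0 rr0).
apply: closed_comp; last exact: interval_closed.
by move=> z _; exact: continuous_dist2.
Qed.

Lemma annulus_interior c (r rr : R) z : 0 <= r -> 0 <= rr ->
  (r = 0 \/ r ^+ 2 < dotp (z - c) (z - c)) -> dotp (z - c) (z - c) < rr ^+ 2 ->
  interior (annulus c r rr) z.
Proof.
move=> r0 rr0 rz zr.
have up : \forall y \near z, dotp (y - c) (y - c) < rr ^+ 2.
  exact: (continuous_dist2 (c := c) (x := z)) (lt_nbhsl zr).
have lo : \forall y \near z, r ^+ 2 <= dotp (y - c) (y - c).
  case: rz => [->|rz].
    by apply: (@filterE _ _ (nbhs_filter z)) => y; rewrite expr0n dotp_ge0.
  have lo : \forall y \near z, r ^+ 2 < dotp (y - c) (y - c).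
    exact: (cvgr_gt _ (@continuous_dist2 c z)).
  by apply: (@filterS _ _ (nbhs_filter z) _ _ _ lo) => y /ltW.
apply: (@filterS2 _ _ (nbhs_filter z) _ _ _ _ up lo) => y yr ry.
by apply/annulusP => //; rewrite ry ltW.
Qed.

(** Partial derivatives are bounded on the compact annulus, so the mean value theorem on
    axis-parallel segments gives the hypotheses of [ring_lip]; [McShane_extension] then leaves the
    annulus. *)
Lemma C1_annulus_lip c (r rr : R) (h : R * R -> R) : 0 <= r -> r < rr ->
  compact (annulus c r rr) -> C1_on_real (annulus c r rr) h ->
  exists2 L, 0 <= L & exists2 g, lip L g & forall z, annulus c r rr z -> g z = h z.
Proof.
move=> r0 rrr cK [ch dh]; set K := annulus c r rr in cK ch dh *.
have rr0 : 0 <= rr := le_trans r0 (ltW rrr).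
have [dh1 [cdh1 dh1P]] := dh (1, 0) (or_introl erefl).
have [dh2 [cdh2 dh2P]] := dh (0, 1) (or_intror erefl).
have [B1 B10 B1P] := compact_continuous_bounded cK cdh1.
have [B2 B20 B2P] := compact_continuous_bounded cK cdh2.
have [M M0 MP] := compact_continuous_bounded cK ch.
have ringE a y : dotp (c + (a, y) - c) (c + (a, y) - c) = a ^+ 2 + y ^+ 2.
  by rewrite addrC addKr /dotp/= -!expr2.
have Kring a y : in_ring r rr a y -> K (c + (a, y)).
  by move=> i; apply/annulusP; rewrite // ringE.
have Kopen a y : in_open_ring r rr a y -> interior K (c + (a, y)).
  by move=> [ra ar]; apply: annulus_interior; rewrite // ringE.
have e1E a y : c + (a, y) = c + (0, y) + a *: (1, 0).
  by apply: injective_projections; rewrite /= /GRing.scale/=; ring.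
have e2E a y : c + (y, a) = c + (y, 0) + a *: (0, 1).
  by apply: injective_projections; rewrite /= /GRing.scale/=; ring.
have itv_open (Q : R -> Prop) a1 a2 : Q a1 -> Q a2 -> (forall t, a1 < t < a2 -> Q t) ->
    forall t, a1 <= t <= a2 -> Q t.
  move=> Q1 Q2 Qo t /andP[]; rewrite le_eqVlt => /orP[/eqP <-//|a1t].
  by rewrite le_eqVlt => /orP[/eqP ->//|ta2]; apply: Qo; rewrite a1t.
have hor : horiz_lip r rr (B1 + B2) (fun a y => h (c + (a, y))).
  move=> y a1 a2 a12 i1 i2 io; rewrite (e1E a1) (e1E a2).
  apply: (line_lip (df := dh1) a12 ch).
  - apply: itv_open; rewrite -?e1E; [exact: Kring|exact: Kring|].
    by move=> t /io /in_open_ringW; rewrite -e1E; exact: Kring.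
  - by move=> t /io /Kopen; rewrite e1E; exact: dh1P.
  - by move=> z /B1P H; rewrite (le_trans H)// lerDl.
have ver : vert_lip r rr (B1 + B2) (fun a y => h (c + (a, y))).
  move=> y a1 a2 a12; rewrite /in_ring/in_open_ring ![_ + y ^+ 2]addrC => i1 i2 io.
  rewrite (e2E a1) (e2E a2).
  apply: (line_lip (df := dh2) a12 ch).
  - apply: itv_open; rewrite -?e2E; [exact: Kring|exact: Kring|].
    by move=> t /io; rewrite addrC => /in_open_ringW; rewrite -e2E; exact: Kring.
  - by move=> t /io; rewrite addrC => /Kopen; rewrite e2E; exact: dh2P.
  - by move=> z /B2P H; rewrite (le_trans H)// lerDr.
have [L L0 LP] := ring_lip r0 rrr (addr_ge0 B10 B20) M0 hor ver
  (fun a y i => MP _ (Kring _ _ i)).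
exists L => //; apply: McShane_extension => // x y Kx Ky.
have toring z : K z -> in_ring r rr (z - c).1 (z - c).2.
  by move=> /annulusP => /(_ r0 rr0); rewrite /dotp -!expr2.
have cE z : c + ((z - c).1, (z - c).2) = z by rewrite -surjective_pairing addrC subrK.
have := LP _ _ _ _ (toring x Kx) (toring y Ky); rewrite !cE.
by rewrite [`|x - y|]/Num.norm/= !opprB ![_ + (c.1 - _)]addrA ![_ + (c.2 - _)]addrA !subrK.
Qed.

End annulus_lip.

(** * Counting tangent lines and matching circles *)

Lemma dotp_perp_eq0 (R : realType) (v w : R * R) :
  v != 0 -> dotp w v = 0 -> dotp w (perp v) = 0 -> w = 0.
Proof.
move=> v0; rewrite /dotp/perp/= => d1 d2.
have v2 : v.1 ^+ 2 + v.2 ^+ 2 != 0.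
  apply: contra v0; rewrite paddr_eq0 ?sqr_ge0// !sqrf_eq0 => /andP[/eqP v1 /eqP v2].
  by apply/eqP; apply: injective_projections.
have w1 : w.1 * (v.1 ^+ 2 + v.2 ^+ 2) = 0.
  have -> : w.1 * (v.1 ^+ 2 + v.2 ^+ 2) =
    v.1 * (w.1 * v.1 + w.2 * v.2) - v.2 * (w.1 * - v.2 + w.2 * v.1) by ring.
  by rewrite d1 d2 !mulr0 subr0.
have w2 : w.2 * (v.1 ^+ 2 + v.2 ^+ 2) = 0.
  have -> : w.2 * (v.1 ^+ 2 + v.2 ^+ 2) =
    v.2 * (w.1 * v.1 + w.2 * v.2) + v.1 * (w.1 * - v.2 + w.2 * v.1) by ring.
  by rewrite d1 d2 !mulr0 addr0.
by apply: injective_projections => /=; apply/eqP;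
  [move/eqP: w1|move/eqP: w2]; rewrite mulf_eq0 (negbTE v2) orbF.
Qed.

(* The solutions are distinguished by the sign of their component along
   [perp v], whose square is determined. *)
Lemma card_dotp_eq (R : realType) (L : nat) (theta : 'I_L -> R * R) (v : R * R) (a : R) :
  (forall l, enorm (theta l) = 1) -> injective theta -> v != 0 ->
  (#|[set l | dotp (theta l) v == a]%SET| <= 2)%N.
Proof.
move=> th1 thI v0; pose f l := (0 <= dotp (theta l) (perp v)).
have finj : {in [set l | dotp (theta l) v == a]%SET &, injective f}.
  move=> l l'; rewrite !inE => /eqP la /eqP la' ff.
  have sq k : dotp (theta k) v = a ->
      dotp (theta k) (perp v) ^+ 2 = dotp v v - a ^+ 2.
    move=> ka; have := enorm1_dotp (th1 k).
    rewrite -ka -[dotp v v]mulr1 => <-; rewrite /dotp/perp/=; ring.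
  have bb : dotp (theta l) (perp v) = dotp (theta l') (perp v).
    have : dotp (theta l) (perp v) ^+ 2 = dotp (theta l') (perp v) ^+ 2.
      by rewrite !sq.
    move/eqP; rewrite eqf_sqr => /orP[/eqP//|/eqP bN]; move: ff; rewrite /f bN.
    rewrite oppr_ge0; case: (ltrgtP 0 (dotp (theta l') (perp v))) => //.
    by move=> <- _; rewrite oppr0.
  apply: thI; apply/eqP; rewrite -subr_eq0; apply/eqP.
  apply: (dotp_perp_eq0 v0).
    have -> : dotp (theta l - theta l') v = dotp (theta l) v - dotp (theta l') v.
      by rewrite /dotp/=; ring.
    by rewrite la la' subrr.
  have -> : dotp (theta l - theta l') (perp v) =
      dotp (theta l) (perp v) - dotp (theta l') (perp v).
    by rewrite /dotp/=; ring.
  by rewrite bb subrr.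
by rewrite -(card_in_imset finj) (leq_trans (max_card _))// card_bool.
Qed.

Lemma card_bigcup_le (I T : finType) (J : {set I}) (S : I -> {set T}) k :
  (forall j, j \in J -> #|S j| <= k)%N ->
  (#|\bigcup_(j in J) S j|%SET <= #|J| * k)%N.
Proof.
move=> Sk; rewrite -sum_nat_const.
elim/big_rec2: _ => [|j n A jJ An]; first by rewrite cards0.
by rewrite (leq_trans (leq_card_setU _ _))// leq_add// Sk.
Qed.

Section matching.
Variable R : realType.

Definition radius (T : Type) (r rr : T -> R) (m : T) (outer : bool) : R :=
  if outer then rr m else r m.

Definition radially_disjoint M (c : 'I_M -> R * R) (r rr : 'I_M -> R) :=
  forall m m' rho, c m = c m' -> r m <= rho <= rr m -> r m' <= rho <= rr m' -> m = m'.

(** An inner radius 0 gives no circle, hence the restriction to positive radii. *)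
Definition circles_in M (c : 'I_M -> R * R) r rr M' (c' : 'I_M' -> R * R) r' rr' :=
  forall m o, 0 < radius r rr m o ->
    exists m' o', c' m' = c m /\ radius r' rr' m' o' = radius r rr m o.

Definition matched M (c : 'I_M -> R * R) (r rr : 'I_M -> R)
    M' (c' : 'I_M' -> R * R) (r' rr' : 'I_M' -> R) (m : 'I_M) : Prop :=
  exists m', [/\ c' m' = c m, r' m' = r m & rr' m' = rr m].

(* Around each centre the annuli are determined from the outside in: in the
   other source, a circle which is an outer one here cannot be an inner one,
   since the surrounding annulus would then occur here too. *)
Lemma matched_step M (c : 'I_M -> R * R) (r rr : 'I_M -> R)
    M' (c' : 'I_M' -> R * R) (r' rr' : 'I_M' -> R) (m : 'I_M) :
  (forall m, 0 <= r m) -> (forall m, r m < rr m) -> radially_disjoint c r rr ->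
  (forall m, 0 <= r' m) -> (forall m, r' m < rr' m) -> radially_disjoint c' r' rr' ->
  circles_in c r rr c' r' rr' -> circles_in c' r' rr' c r rr ->
  (forall m', rr m < rr' m' -> matched c' r' rr' c r rr m') ->
  matched c r rr c' r' rr' m.
Proof.
move=> r0 rlt D r0' rlt' D' C C' IH.
have rr0 : 0 < rr m := le_lt_trans (r0 m) (rlt m).
have [m' [[] [cm' /= rrm']]] := C m true rr0.
  exists m'; split => //.
  (* If the inner radii differ, the larger one is positive, hence the radius of a circle of the
     other source too. It lies strictly between the radii of the annulus there, so by disjointness
     it would have to bound that very annulus. *)
  have [r_lt|r_lt|//] := ltgtP (r' m') (r m).
    have rm0 : 0 < r m := le_lt_trans (r0' m') r_lt.
    have [m'' [ou [cm'' rm'']]] := C m false rm0; rewrite /= in rm''.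
    have E : m'' = m'.
      apply: (D' _ _ (r m)); first by rewrite cm'' cm'.
        by rewrite -rm'' /radius; case: (ou); rewrite ?lexx ?andbT /= ltW.
      by rewrite rrm' !ltW.
    subst m''; case: ou rm'' => /= rm''.
      by have := rlt m; rewrite -rm'' rrm' ltxx.
    by move: r_lt; rewrite rm'' ltxx.
  have rm0 : 0 < r' m' := le_lt_trans (r0 m) r_lt.
  have [m'' [ou [cm'' rm'']]] := C' m' false rm0; rewrite /= in rm''.
  have E : m'' = m.
    apply: (D _ _ (r' m')); first by rewrite cm'' cm'.
      by rewrite -rm'' /radius; case: (ou); rewrite ?lexx ?andbT /= ltW.
    by rewrite (ltW r_lt)/= -rrm' ltW.
  subst m''; case: ou rm'' => /= rm''.
    by have := rlt' m'; rewrite -rm'' rrm' ltxx.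
  by move: r_lt; rewrite rm'' ltxx.
have [m'' [cm'' rm'' _]] : matched c' r' rr' c r rr m' by apply: IH; rewrite -rrm'.
have E : m'' = m.
  apply: (D _ _ (rr m)); first by rewrite cm'' cm'.
    by rewrite rm'' rrm' lexx -rrm' -rm'' ltW.
  by rewrite lexx andbT ltW.
by have := rlt m; rewrite -E rm'' rrm' E ltxx.
Qed.

(** Both claims are proved at once on the sum of the index types: an unmatched annulus of largest
    outer radius in the two sources satisfies the hypotheses of [matched_step]. *)
Lemma all_matched M (c : 'I_M -> R * R) (r rr : 'I_M -> R)
    M' (c' : 'I_M' -> R * R) (r' rr' : 'I_M' -> R) :
  (forall m, 0 <= r m) -> (forall m, r m < rr m) -> radially_disjoint c r rr ->
  (forall m, 0 <= r' m) -> (forall m, r' m < rr' m) -> radially_disjoint c' r' rr' ->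
  circles_in c r rr c' r' rr' -> circles_in c' r' rr' c r rr ->
  (forall m, matched c r rr c' r' rr' m) /\ (forall m, matched c' r' rr' c r rr m).
Proof.
move=> r0 rlt D r0' rlt' D' C C'.
pose P (t : 'I_M + 'I_M') := match t with
  | inl m => matched c r rr c' r' rr' m | inr m => matched c' r' rr' c r rr m end.
suff PT t : P t by split=> m; [exact: (PT (inl m))|exact: (PT (inr m))].
apply: contrapT => nP.
pose F (t : 'I_M + 'I_M') := match t with inl m => rr m | inr m => rr' m end.
have nPt : (fun t => `[< ~ P t >]) t by exact/asboolP.
case: (@Order.TotalTheory.arg_maxP _ _ _ t (fun t => `[< ~ P t >]) F nPt).
move=> s /asboolP nPs sF; apply: nPs.
case: s sF => m sF /=.
  apply: (matched_step r0 rlt D r0' rlt' D' C C') => m' mm'.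
  apply: contrapT => nm'; have := sF (inr m').
  by move=> /(_ (asboolT nm')) /=; rewrite leNgt mm'.
apply: (matched_step r0' rlt' D' r0 rlt D C' C) => m' mm'.
apply: contrapT => nm'; have := sF (inl m').
by move=> /(_ (asboolT nm')) /=; rewrite leNgt mm'.
Qed.

End matching.

(** * Sources *)

Section tame_functions.
Variable R : realType.
Notation mu := (@lebesgue_measure R).
Notation mu2 := (mu \x mu)%E.
Local Notation plane := (measurableTypeR R * measurableTypeR R)%type.

Definition tame (h : R * R -> R) := measurable_fun setT (h : plane -> R) /\
  exists A B, (forall z, `|h z| <= B) /\ (forall z, A < dotp z z -> h z = 0).

Definition cos_int (h : R * R -> R) (th : R * R) (k : R) :=
  \int[mu2]_y (cos (k * dotp th y) * h y).
Definition sin_int (h : R * R -> R) (th : R * R) (k : R) :=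
  \int[mu2]_y (sin (k * dotp th y) * h y).

Lemma cos_shift_integrable h th k beta : tame h ->
  mu2.-integrable setT (EFin \o (fun y => cos (k * dotp th y + beta) * h y)).
Proof.
move=> [mh [A [B [hB hA]]]].
apply: (weighted_integrable mh hB hA th (phi := fun x => cos (k * x + beta)) (C := 1)).
  by apply: continuous_measurable_fun; exact: continuous_cos_affine.
by move=> x; exact: cos_max.
Qed.

Lemma cos_integrable h th k : tame h ->
  mu2.-integrable setT (EFin \o (fun y => cos (k * dotp th y) * h y)).
Proof.
move=> /(cos_shift_integrable th k 0).
by under [X in _ \o X]eq_fun do rewrite addr0.
Qed.

Lemma sin_integrable h th k : tame h ->
  mu2.-integrable setT (EFin \o (fun y => sin (k * dotp th y) * h y)).
Proof.
move=> [mh [A [B [hB hA]]]].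
apply: (weighted_integrable mh hB hA th (phi := fun x => sin (k * x)) (C := 1)).
  apply: continuous_measurable_fun => x.
  have := @continuous_cos_affine R k (- (pi / 2)) x.
  by under [X in continuous_at _ X]eq_fun do rewrite cosBpihalf.
by move=> x; exact: sin_max.
Qed.

Lemma cos_int_shift h th k beta : tame h ->
  \int[mu2]_y (cos (k * dotp th y + beta) * h y) =
  cos beta * cos_int h th k - sin beta * sin_int h th k.
Proof.
move=> th_; have iC := cos_integrable th k th_; have iS := sin_integrable th k th_.
rewrite /cos_int /sin_int -!RintegralZl// -RintegralB//.
- by apply: eq_Rintegral => y _; rewrite cosD; ring.
- exact: (@integrableZl _ _ _ mu2 setT measurableT (cos beta) _ iC).
- exact: (@integrableZl _ _ _ mu2 setT measurableT (sin beta) _ iS).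
Qed.

Lemma far_fieldE (f : R * R -> R[i]) th k :
  tame (fun y => complex.Re (f y)) -> tame (fun y => complex.Im (f y)) ->
  far_field f th k =
   ((cos_int (fun y => complex.Re (f y)) th k +
        sin_int (fun y => complex.Im (f y)) th k)
   +i* (cos_int (fun y => complex.Im (f y)) th k -
        sin_int (fun y => complex.Re (f y)) th k))%C.
Proof.
move=> tR tI; rewrite /far_field /integral_plane; congr (_ +i* _)%C.
  rewrite /cos_int /sin_int -RintegralD//; [|exact: cos_integrable|exact: sin_integrable].
  apply: eq_Rintegral => y _; rewrite /expi; case: (f y) => a b /=.
  by rewrite cosN sinN; ring.
rewrite /cos_int /sin_int -RintegralB//; [|exact: cos_integrable|exact: sin_integrable].
apply: eq_Rintegral => y _; rewrite /expi; case: (f y) => a b /=.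
by rewrite cosN sinN; ring.
Qed.

Lemma dotpN (th y : R * R) : dotp (- th) y = - dotp th y.
Proof. by rewrite /dotp/=; ring. Qed.

Lemma cos_intN h th k : cos_int h (- th) k = cos_int h th k.
Proof.
by apply: eq_Rintegral => y _; rewrite dotpN mulrN cosN.
Qed.

Lemma sin_intN h th k : tame h -> sin_int h (- th) k = - sin_int h th k.
Proof.
move=> th_; rewrite /sin_int -[RHS]mulN1r -RintegralZl//; last exact: sin_integrable.
by apply: eq_Rintegral => y _; rewrite dotpN mulrN sinN; ring.
Qed.

(** Passing from [th] to [- th] keeps the cosine integrals and negates the sine integrals, so sums
    and differences of the two far fields isolate each integral. *)
Lemma far_field_eq_parts (f1 f2 : R * R -> R[i]) th k :
  tame (fun y => complex.Re (f1 y)) -> tame (fun y => complex.Im (f1 y)) ->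
  tame (fun y => complex.Re (f2 y)) -> tame (fun y => complex.Im (f2 y)) ->
  far_field f1 th k = far_field f2 th k ->
  far_field f1 (- th) k = far_field f2 (- th) k ->
  forall part, part = @complex.Re R \/ part = @complex.Im R ->
  cos_int (fun y => part (f1 y)) th k = cos_int (fun y => part (f2 y)) th k /\
  sin_int (fun y => part (f1 y)) th k = sin_int (fun y => part (f2 y)) th k.
Proof.
move=> tR1 tI1 tR2 tI2; rewrite !far_fieldE// !cos_intN !sin_intN//.
move=> [E1 E2] [E3 E4] part [->|->]; split; lra.
Qed.

End tame_functions.

Section source.
Variables (R : realType) (f : R * R -> R[i]) (M : nat) (c : 'I_M -> R * R) (r rr : 'I_M -> R).
Hypotheses (r0 : forall m, 0 <= r m) (rlt : forall m, r m < rr m).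
Hypothesis S : source_assumption f (fun m => annulus (c m) (r m) (rr m)).

Let rr0 m : 0 <= rr m. Proof. exact: le_trans (r0 m) (ltW (rlt m)). Qed.

Lemma annuli_inj m m' z :
  annulus (c m) (r m) (rr m) z -> annulus (c m') (r m') (rr m') z -> m = m'.
Proof.
by move=> zm zm'; apply: (comp_disjoint S) => //; exists z.
Qed.

Lemma source_radially_disjoint : radially_disjoint c r rr.
Proof.
move=> m m' rho cm rm rm'.
have rho0 : 0 <= rho by case/andP: rm => + _; exact: le_trans.
have E : dotp (c m + rho *: (1, 0) - c m) (c m + rho *: (1, 0) - c m) = rho ^+ 2.
  by rewrite addrC addKr /dotp/= /GRing.scale/=; ring.
apply: (@annuli_inj _ _ (c m + rho *: (1, 0))).
  by apply/annulusP; rewrite // E !ler_sqr ?nnegrE.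
by apply/annulusP; rewrite // -cm E !ler_sqr ?nnegrE.
Qed.

Lemma source_eq0 z : (forall m, ~ annulus (c m) (r m) (rr m) z) -> f z = 0.
Proof.
move=> nz; apply/eqP/negPn/negP => fz.
have : supp f z by apply: subset_closure.
by rewrite (supp_cover S) => -[m _]; exact: nz.
Qed.

(** The closed outer disc minus the open inner disc, empty if [r m = 0], is exactly the closed
    annulus. One Lipschitz extension taken with opposite signs on the two thus reproduces [h] at
    every point, boundary included. *)
Lemma source_decomposition (h : R * R -> R) :
  (forall z, f z = 0 -> h z = 0) ->
  (forall m, C1_on_real (annulus (c m) (r m) (rr m)) h) ->
  exists (L : R) (g : 'I_M * bool -> R * R -> R),
  [/\ 0 <= L, forall i, lip L (g i),
      forall m o z, annulus (c m) (r m) (rr m) z ->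
        g (m, o) z = if o then h z else - h z &
      forall z, h z = \sum_i on_disc i.2 (c i.1) (radius r rr i.1 i.2) (g i) z].
Proof.
move=> h0 hC1.
have /choice[Lg LgProp] : forall m, exists p : R * (R * R -> R),
    [/\ 0 <= p.1, lip p.1 p.2 & forall z, annulus (c m) (r m) (rr m) z -> p.2 z = h z].
  move=> m; have [L L0 [g gL gh]] :=
    C1_annulus_lip (r0 m) (rlt m) (@comp_compact _ _ _ _ S m) (hC1 m).
  by exists (L, g).
pose L := \sum_m (Lg m).1.
have L0 : 0 <= L by apply: sumr_ge0 => m _; have [] := LgProp m.
have LgL m : (Lg m).1 <= L.
  rewrite /L (bigD1 m)//= lerDl sumr_ge0// => j _; by have [] := LgProp j.
pose g (i : 'I_M * bool) z := if i.2 then (Lg i.1).2 z else - (Lg i.1).2 z.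
exists L, g; split => //.
- move=> [m o] x y; have [_ gl _] := LgProp m; have H := gl x y.
  have {}H : `|(Lg m).2 x - (Lg m).2 y| <= L * `|x - y|.
    by rewrite (le_trans H)// ler_wpM2r.
  by rewrite /g /=; case: (o) => //; rewrite -opprD normrN.
- by move=> m o z zm; have [_ _ gh] := LgProp m; rewrite /g/= gh.
move=> z.
have ring m : on_disc true (c m) (rr m) (g (m, true)) z +
    on_disc false (c m) (r m) (g (m, false)) z =
    if `[< annulus (c m) (r m) (rr m) z >] then h z else 0.
  have [_ _ gh] := LgProp m.
  rewrite /on_disc /in_disc /= /g /=; case: ifPn => [d1|d1].
    case: ifPn => [d2|d2].
      rewrite subrr; case: asboolP => // /annulusP => /(_ (r0 m) (rr0 m)).
      by rewrite leNgt d2.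
    have zm : annulus (c m) (r m) (rr m) z by apply/annulusP; rewrite // leNgt d2.
    by rewrite addr0 gh//; case: asboolP.
  rewrite -ltNge in d1.
  rewrite ltNge (ltW (le_lt_trans _ d1)) ?ler_sqr ?nnegrE ?(ltW (rlt m))//=.
  rewrite addr0; case: asboolP => // /annulusP => /(_ (r0 m) (rr0 m)).
  by rewrite [X in _ && X]leNgt d1 andbF.
transitivity (\sum_m if `[< annulus (c m) (r m) (rr m) z >] then h z else 0).
  have [[m zm]|nz] := pselect (exists m, annulus (c m) (r m) (rr m) z).
    rewrite (bigD1 m)//= asboolT// big1 ?addr0// => j jm.
    by case: asboolP => // zj; rewrite (annuli_inj zj zm) eqxx in jm.
  rewrite h0; last by apply: source_eq0 => m zm; apply: nz; exists m.
  by rewrite big1// => m _; case: asboolP => // zm; case: nz; exists m.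
rewrite -(pair_bigA _ (fun m o => on_disc o (c m) (radius r rr m o) (g (m, o)) z))/=.
by apply: eq_bigr => m _; rewrite big_bool/= ring.
Qed.

Lemma source_tame (h : R * R -> R) :
  (forall z, f z = 0 -> h z = 0) ->
  (forall m, C1_on_real (annulus (c m) (r m) (rr m)) h) -> tame h.
Proof.
move=> h0 hC1; have [L [g [L0 gL _ hE]]] := source_decomposition h0 hC1.
have rad0 (i : 'I_M * bool) : 0 <= radius r rr i.1 i.2.
  by rewrite /radius; case: ifP.
rewrite (funext hE); split; first exact: measurable_sum_discs gL.
have hB := sum_discs_bounded (fun i : 'I_M * bool => i.2) (fun i => c i.1) rad0 L0 gL.
have hA := @sum_discs_supp _ _ (fun i : 'I_M * bool => i.2) (fun i => c i.1) _ g rad0.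
by do 2 eexists; split; [exact: hB|exact: hA].
Qed.

Lemma closure_annulus_notin m z : annulus (c m) (r m) (rr m) z ->
  \forall y \near z, forall m', m' != m -> ~ annulus (c m') (r m') (rr m') y.
Proof.
move=> zm; apply: (@filter_forall _ _
  (fun m' y => m' != m -> ~ annulus (c m') (r m') (rr m') y)
  _ (nbhs_filter z)) => m'.
have [->|m'm] := eqVneq m' m; first exact: (@filterE _ _ (nbhs_filter z)).
have oC : open (~` annulus (c m') (r m') (rr m')).
  by rewrite openC; exact: annulus_closed.
have zC : (~` annulus (c m') (r m') (rr m')) z.
  by move=> zm'; rewrite (annuli_inj zm' zm) eqxx in m'm.
by apply: (@filterS _ _ (nbhs_filter z) _ _ _ (open_nbhs_nbhs (conj oC zC))) => y yC _.
Qed.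

(** The other annuli are closed and finitely many, so near this point the support is the annulus [m]
    alone, and a small radial move, outwards or inwards according to [o], leaves it. *)
Lemma circle_bdry m o th : enorm th = 1 -> 0 < radius r rr m o ->
  bdry (supp f) (c m + radius r rr m o *: th).
Proof.
move=> /enorm1_dotp th1 rad0; set rho := radius r rr m o in rad0 *.
set p := c m + rho *: th.
have distE t : dotp (c m + t *: th - c m) (c m + t *: th - c m) = t ^+ 2.
  rewrite addrC addKr -[RHS]mulr1 -th1 /dotp/= /GRing.scale/=; ring.
have pm : annulus (c m) (r m) (rr m) p.
  apply/annulusP; rewrite // distE /rho /radius.
  by case: (o); rewrite !ler_sqr ?nnegrE// lexx ltW.
split.
  by apply: subset_closure; rewrite (supp_cover S); exists m.
move=> pint.
have near_p : \forall y \near p, annulus (c m) (r m) (rr m) y.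
  apply: (@filterS2 _ _ (nbhs_filter p) _ _ _ _ pint (closure_annulus_notin pm)) => y.
  rewrite (supp_cover S) => -[m' _ ym'] nm'.
  by have [E|/nm'//] := eqVneq m' m; rewrite -E.
have cline : (fun t : R => c m + t *: th) @ rho --> p.
  by apply: cvgD; [exact: cvg_cst|exact: scalel_continuous].
have /nbhs_ballP[e /= e0 eP] : \forall t \near rho, annulus (c m) (r m) (rr m) (c m + t *: th).
  exact: cline near_p.
case: o @rho rad0 p distE pm pint near_p cline eP => /= rad0 p distE pm pint near_p cline eP.
  have : annulus (c m) (r m) (rr m) (c m + (rr m + e / 2) *: th).
    apply: eP; rewrite /ball/= opprD addrA subrr sub0r normrN gtr0_norm ?divr_gt0//.
    by rewrite ltr_pdivrMr// ltr_pMr// ltr1n.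
  move/annulusP => /(_ (r0 m) (rr0 m)) /andP[_]; rewrite distE.
  by rewrite ler_sqr ?nnegrE ?addr_ge0 ?divr_ge0 ?(ltW e0)// gerDl leNgt divr_gt0.
(* The maximum keeps [t] nonnegative when [e] is large. *)
pose t := Num.max (r m - e / 2) (r m / 2).
have t0 : 0 <= t by rewrite le_max divr_ge0 ?orbT.
have tr : t < r m by rewrite gt_max; apply/andP; split; lra.
have te : r m - e / 2 <= t by rewrite le_max lexx.
have : annulus (c m) (r m) (rr m) (c m + t *: th).
  by apply: eP; rewrite /ball/= gtr0_norm; lra.
move/annulusP => /(_ (r0 m) (rr0 m)) /andP[+ _]; rewrite distE.
by rewrite ler_sqr ?nnegrE// leNgt tr.
Qed.

End source.

(** * Uniqueness *)

Lemma on_discN (R : realType) b (c : R * R) rho g z :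
  on_disc b c rho (fun y => - g y) z = - on_disc b c rho g z.
Proof. by rewrite /on_disc; case: ifP => _ //; rewrite oppr0. Qed.

Section uniqueness.
Variables (R : realType) (L : nat) (theta : 'I_L -> R * R).
Hypothesis theta_unit : forall l, enorm (theta l) = 1.
Hypothesis theta_ncol : forall l l', l != l' -> ~ collinear (theta l) (theta l').
Variables (kmin kmax : R).
Hypothesis kmin_lt_kmax : kmin < kmax.

Lemma theta_inj : injective theta.
Proof.
move=> l l' ll'; apply/eqP/negPn/negP => /theta_ncol; apply.
by exists 1; rewrite scale1r.
Qed.

Variables (f1 : R * R -> R[i]) (M1 : nat) (c1 : 'I_M1 -> R * R) (r1 R1 : 'I_M1 -> R).
Variables (f2 : R * R -> R[i]) (M2 : nat) (c2 : 'I_M2 -> R * R) (r2 R2 : 'I_M2 -> R).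
Hypotheses (r1_ge0 : forall m, 0 <= r1 m) (r1_lt_R1 : forall m, r1 m < R1 m).
Hypothesis f1_source : source_assumption f1 (fun m => annulus (c1 m) (r1 m) (R1 m)).
Hypotheses (r2_ge0 : forall m, 0 <= r2 m) (r2_lt_R2 : forall m, r2 m < R2 m).
Hypothesis f2_source : source_assumption f2 (fun m => annulus (c2 m) (r2 m) (R2 m)).
Hypothesis L_large : (4 * (M1 + M2) < L + 4)%N.
Hypothesis far_eq : forall (l : 'I_L) (k : R), kmin < k < kmax ->
  far_field f1 (theta l) k = far_field f2 (theta l) k /\
  far_field f1 (- theta l) k = far_field f2 (- theta l) k.

Local Notation I := (('I_M1 * bool) + ('I_M2 * bool))%type.

Let cI (i : I) := match i with inl j => c1 j.1 | inr j => c2 j.1 end.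
Let rI (i : I) :=
  match i with inl j => radius r1 R1 j.1 j.2 | inr j => radius r2 R2 j.1 j.2 end.
Let bI (i : I) := match i with inl j => j.2 | inr j => j.2 end.

Let rI_ge0 i : 0 <= rI i.
Proof.
case: i => -[m o] /=; rewrite /radius; case: o => //.
  by rewrite (le_trans (r1_ge0 m))// ltW.
by rewrite (le_trans (r2_ge0 m))// ltW.
Qed.

(* Two circles have a common tangent line with normal [theta l], on the same
   side, for at most two [l]; the circles centred at [c1 m0] are not counted,
   and at least two of them belong to the annulus [m0]. *)
Lemma isolating_direction m0 o0 :
  (forall j : I, j != inl (m0, o0) -> cI j = c1 m0 -> rI j != radius r1 R1 m0 o0) ->
  exists l, forall j : I, j != inl (m0, o0) ->
    dotp (theta l) (cI j) + rI j != dotp (theta l) (c1 m0) + radius r1 R1 m0 o0.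
Proof.
move=> conc; pose rho0 := radius r1 R1 m0 o0.
pose J := [set j : I | cI j != c1 m0]%SET.
pose S (j : I) := [set l | dotp (theta l) (cI j - c1 m0) == rho0 - rI j]%SET.
have cardJ : (#|J| + 2 <= 2 * (M1 + M2))%N.
  pose X := [set (inl (m0, true) : I); inl (m0, false)]%SET.
  have JX : J :&: X = finset.set0.
    apply/setP => j; rewrite !inE andbC; apply/negbTE/negP.
    by case/andP => /orP[] /eqP ->; rewrite /= eqxx.
  have <- : #|{: I}| = (2 * (M1 + M2))%N.
    by rewrite card_sum !card_prod !card_ord card_bool; lia.
  have <- : #|X| = 2%N by rewrite cards2; case: eqP => [[]|].
  by rewrite -cardsUI JX cards0 addn0 max_card.
have cardU : (#|\bigcup_(j in J) S j|%SET < L)%N.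
  have : (#|\bigcup_(j in J) S j|%SET <= #|J| * 2)%N.
    apply: card_bigcup_le => j; rewrite inE -subr_eq0 => cj.
    exact: card_dotp_eq theta_unit theta_inj cj.
  by move: cardJ L_large; lia.
have [l lU] : exists l, l \notin (\bigcup_(j in J) S j)%SET.
  apply/existsP; rewrite -negb_forall; apply: contraL cardU => /forallP allU.
  rewrite -leqNgt -[leqLHS]card_ord subset_leq_card//.
  by apply/fintype.subsetP => l _; exact: allU.
exists l => j jn; have [cj|cj] := eqVneq (cI j) (c1 m0).
  by rewrite cj (inj_eq (addrI _)); exact: conc.
apply: contra lU => /eqP E; apply/bigcupP; exists j; first by rewrite inE.
rewrite inE; apply/eqP.
rewrite (_ : dotp _ _ = dotp (theta l) (cI j) - dotp (theta l) (c1 m0)).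
  by move: E; rewrite -/rho0; lra.
by rewrite /dotp/=; ring.
Qed.

Lemma circles_determined : circles_in c1 r1 R1 c2 r2 R2.
Proof.
move=> m0 o0 rho0_gt0; apply: contrapT => nE; set rho0 := radius _ _ _ _ in rho0_gt0 nE.
have [|l lsep] := @isolating_direction m0 o0.
  (* An equal concentric circle is excluded in the second source by [nE]. In the first, disjointness
     puts it in the annulus [m0], whose two radii differ. *)
  move=> [[m o]|[m o]] /= jn cm; apply/eqP => rm; last first.
    by apply: nE; exists m, o.
  have R1_ge0 : forall m, 0 <= R1 m by move=> k; rewrite (le_trans (r1_ge0 k))// ltW.
  have between k o1 : r1 k <= radius r1 R1 k o1 <= R1 k.
    by rewrite /radius; case: o1; rewrite lexx ?andbT ltW.
  have mm : m = m0.
    apply: (source_radially_disjoint r1_ge0 r1_lt_R1 f1_source cm (rho := rho0)).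
      by rewrite /rho0 -rm between.
    exact: between.
  subst m; have oo : o != o0 by apply: contra jn => /eqP ->.
  have := r1_lt_R1 m0.
  by move: oo rm; rewrite /radius; case: (o); case: (o0) => // _ ->; rewrite ltxx.
set th := theta l in lsep; have th1 : enorm th = 1 := theta_unit l.
have fp : f1 (c1 m0 + rho0 *: th) != 0.
  apply: (bdry_neq0 f1_source).
  exact: (circle_bdry r1_ge0 r1_lt_R1 f1_source).
set p := _ + _ in fp.
(* The tangent line argument is for real functions: it is applied to a part of [f1 - f2] for which
   that of [f1] does not vanish at [p]. *)
have [part [partRI part_p]] : exists part, (part = @complex.Re R \/ part = @complex.Im R) /\
    part (f1 p) != 0.
  have [Re0|] := eqVneq (complex.Re (f1 p)) 0; last by exists (@complex.Re R); split; [left|].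
  exists (@complex.Im R); split; first by right.
  by apply: contra fp => Im0; rewrite eq_complex Re0 eqxx.
have part0 : part 0 = 0 by case: partRI => ->.
have [p1C p2C] : (forall m, C1_on_real (annulus (c1 m) (r1 m) (R1 m)) (part \o f1)) /\
    (forall m, C1_on_real (annulus (c2 m) (r2 m) (R2 m)) (part \o f2)).
  by split=> m; [have [] := comp_C1 f1_source m|have [] := comp_C1 f2_source m];
    case: partRI => ->.
have t1 part' : part' = @complex.Re R \/ part' = @complex.Im R -> tame (fun y => part' (f1 y)).
  move=> P; apply: (source_tame r1_ge0 r1_lt_R1 f1_source).
    by move=> z ->; case: P => ->.
  by move=> m; have [] := comp_C1 f1_source m; case: P => ->.
have t2 part' : part' = @complex.Re R \/ part' = @complex.Im R -> tame (fun y => part' (f2 y)).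
  move=> P; apply: (source_tame r2_ge0 r2_lt_R2 f2_source).
    by move=> z ->; case: P => ->.
  by move=> m; have [] := comp_C1 f2_source m; case: P => ->.
have [L1 [g1 [L10 g1L g1E h1E]]] := source_decomposition r1_ge0 r1_lt_R1 f1_source
  (h := part \o f1) (fun z E => etrans (congr1 part E) part0) p1C.
have [L2 [g2 [L20 g2L _ h2E]]] := source_decomposition r2_ge0 r2_lt_R2 f2_source
  (h := part \o f2) (fun z E => etrans (congr1 part E) part0) p2C.
pose gI (i : I) z := match i with inl j => g1 j z | inr j => - g2 j z end.
have gIL i : lip (L1 + L2) (gI i).
  case: i => j x y /=.
    by rewrite (le_trans (g1L j x y))// ler_wpM2r// lerDl.
  by rewrite -opprD normrN (le_trans (g2L j x y))// ler_wpM2r// lerDr.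
have HE z : \sum_i on_disc (bI i) (cI i) (rI i) (gI i) z = part (f1 z) - part (f2 z).
  rewrite big_sumType/= -[part (f1 z)]/((part \o f1) z) h1E.
  rewrite -[part (f2 z)]/((part \o f2) z) h2E -sumrN; congr (_ + _).
  by apply: eq_bigr => j _; rewrite -on_discN.
have gp : gI (inl (m0, o0)) (c1 m0 + rho0 *: th) = 0.
  apply: (@tangent_value_eq0 R I bI cI rI gI (L1 + L2) rI_ge0 (addr_ge0 L10 L20) gIL
    th th1 kmin kmax kmin_lt_kmax _ (inl (m0, o0))) => //.
  move=> k beta kP; under eq_Rintegral do rewrite HE mulrBr.
  have [fe fe'] := far_eq l kP.
  have [Ec Es] := far_field_eq_parts (t1 _ (or_introl erefl)) (t1 _ (or_intror erefl))
    (t2 _ (or_introl erefl)) (t2 _ (or_intror erefl)) fe fe' partRI.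
  rewrite RintegralB//; last 2 first.
  - exact: cos_shift_integrable (t1 _ partRI).
  - exact: cos_shift_integrable (t2 _ partRI).
  rewrite !cos_int_shift; [|exact: t2|exact: t1].
  by rewrite -/th Ec Es subrr.
have pm : annulus (c1 m0) (r1 m0) (R1 m0) p.
  apply/annulusP => //; first by rewrite (le_trans (r1_ge0 m0))// ltW.
  have -> : dotp (p - c1 m0) (p - c1 m0) = rho0 ^+ 2.
    rewrite /p addrC addKr -[RHS]mulr1 -(enorm1_dotp th1) /dotp/= /GRing.scale/=; ring.
  have R10 : 0 <= R1 m0 by rewrite (le_trans (r1_ge0 m0))// ltW.
  by rewrite /rho0 /radius; case: (o0); rewrite !ler_sqr ?nnegrE// lexx ?andbT ltW.
move: gp; rewrite /gI g1E//=; case: (o0) => /eqP; rewrite ?oppr_eq0; exact/negP.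
Qed.

End uniqueness.

Theorem theorem3p2 (R : realType)
  (L : nat) (theta : 'I_L -> R * R)
  (theta_unit : forall l, enorm (theta l) = 1)
  (theta_ncol : forall l l', l != l' -> ~ collinear (theta l) (theta l'))
  (kmin kmax : R) (kmin_gt0 : 0 < kmin) (kmin_lt_kmax : kmin < kmax)
  (f1 : R * R -> R[i]) (M1 : nat) (c1 : 'I_M1 -> R * R) (r1 R1 : 'I_M1 -> R)
  (r1_ge0 : forall m, 0 <= r1 m) (R1_gt0 : forall m, 0 < R1 m)
  (r1_lt_R1 : forall m, r1 m < R1 m)
  (f1_source : source_assumption f1 (fun m => annulus (c1 m) (r1 m) (R1 m)))
  (L_gt1 : 8%:Z * M1%:Z - 4%:Z < L%:Z)
  (f2 : R * R -> R[i]) (M2 : nat) (c2 : 'I_M2 -> R * R) (r2 R2 : 'I_M2 -> R)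
  (r2_ge0 : forall m, 0 <= r2 m) (R2_gt0 : forall m, 0 < R2 m)
  (r2_lt_R2 : forall m, r2 m < R2 m)
  (f2_source : source_assumption f2 (fun m => annulus (c2 m) (r2 m) (R2 m)))
  (L_gt2 : 8%:Z * M2%:Z - 4%:Z < L%:Z)
  (far_eq : forall (l : 'I_L) (k : R), kmin < k < kmax ->
     far_field f1 (theta l) k = far_field f2 (theta l) k /\
     far_field f1 (- theta l) k = far_field f2 (- theta l) k) :
  range (fun m => annulus (c1 m) (r1 m) (R1 m)) =
  range (fun m => annulus (c2 m) (r2 m) (R2 m)).
Proof.
(* Half the sum of the two bounds on [L], with the 4 moved across to avoid truncated subtraction. *)
have L12 : (4 * (M1 + M2) < L + 4)%N.
  by move: L_gt1 L_gt2; lia.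
have far_eq' (l : 'I_L) (k : R) : kmin < k < kmax ->
    far_field f2 (theta l) k = far_field f1 (theta l) k /\
    far_field f2 (- theta l) k = far_field f1 (- theta l) k.
  by move=> /(far_eq l)[].
have C12 := circles_determined theta_unit theta_ncol kmin_lt_kmax r1_ge0 r1_lt_R1
  f1_source r2_ge0 r2_lt_R2 f2_source L12 far_eq.
rewrite addnC in L12.
have C21 := circles_determined theta_unit theta_ncol kmin_lt_kmax r2_ge0 r2_lt_R2
  f2_source r1_ge0 r1_lt_R1 f1_source L12 far_eq'.
have [M12 M21] := all_matched r1_ge0 r1_lt_R1
  (source_radially_disjoint r1_ge0 r1_lt_R1 f1_source) r2_ge0 r2_lt_R2
  (source_radially_disjoint r2_ge0 r2_lt_R2 f2_source) C12 C21.
apply/seteqP; split => _ [m _ <-].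
  by have [m' [cm rm Rm]] := M12 m; exists m'; rewrite // cm rm Rm.
by have [m' [cm rm Rm]] := M21 m; exists m'; rewrite // cm rm Rm.
Qed.
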